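(* Let $\sigma>0$ and $\tau\in\mathbb{R}$. The domain of convergence of the series $$\sum_{n=1}^\infty \sum_{m=1}^n (-1)^{n-m}\genfrac{[}{]}{0pt}{}{n}{n-m+1}\frac{\sigma^{n-m}\tau^{m}}{m!}$$ (in the variables $(\sigma,\tau)$) is defined by the inequality $$\ln\sigma<1-\frac{\tau}{\sigma}+\operatorname{Re} W_{-1}\left(-e^{\frac{\tau}{\sigma}-1}\right).$$
   Context: $\genfrac{[}{]}{0pt}{}{n}{k}$ is the (unsigned) Stirling cycle number: the number of permutations of $n$ elements with exactly $k$ cycles. The series is summed as an outer series over $n$ of the finite inner sums over $m$. ''Domain of convergence'' has its usual meaning: the open region of points $(\sigma,\tau)$, $\sigma>0$, $\tau\in\mathbb{R}$, in which the series converges (the interior of the set of points of convergence). $W_{-1}$ is the branch $-1$ of the Lambert $W$ function (the multivalued inverse of $w\mapsto we^w$); for $-1/e\le x<0$, $W_{-1}(x)$ is the real solution $w\le -1$ of $we^w=x$, and for $x<-1/e$ it is the solution $w$ of $we^w=x$ with $-\pi<\operatorname{Im} w<0$. *)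

(* Defs.v *)
From HB Require Import structures.
From mathcomp Require Import all_boot all_order all_algebra all_fingroup.
From mathcomp Require Import all_classical all_reals all_analysis.
From mathcomp Require Import complex.

Set Implicit Arguments.
Unset Strict Implicit.
Unset Printing Implicit Defensive.

Import Order.TTheory GRing.Theory Num.Theory.
Import numFieldNormedType.Exports.

Local Open Scope classical_set_scope.
Local Open Scope ring_scope.

(* [porbits s] contains the fixed points of [s] as singletons, so that
   one-element cycles are counted. *)
Definition stirling_cycle (n k : nat) : nat :=
  #|[set s : 'S_n | #|porbits s| == k]%SET|.

Definition expC (R : realType) (z : R[i]) : R[i] :=
  Complex (expR (complex.Re z) * cos (complex.Im z))
          (expR (complex.Re z) * sin (complex.Im z)).

(* The value at a real x < 0 of the branch -1 of the Lambert W function; the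
   real solution -1 is taken at the branch point x = -1/e. *)
Definition is_lambertWm1 (R : realType) (x : R) (w : R[i]) : Prop :=
  w * expC w = Complex x 0 /\
  if - expR (- 1) <= x then complex.Im w = 0 /\ complex.Re w <= - 1
  else - pi < complex.Im w /\ complex.Im w < 0.

(* Only meaningful for x < 0, where [is_lambertWm1 x] has exactly one solution;
   the default value 0 is a convention for the other x. *)
Definition lambertWm1 (R : realType) (x : R) : R[i] :=
  xget 0 [set w : R[i] | is_lambertWm1 x w].

Definition inner_sum (R : realType) (s t : R) (n : nat) : R :=
  \sum_(1 <= m < n.+1)
    (- 1) ^+ (n - m) * (stirling_cycle n (n - m).+1)%:R
    * (s ^+ (n - m) * t ^+ m / m`!%:R).

Definition series_converges (R : realType) (s t : R) : Prop :=
  cvgn (fun N : nat => \sum_(1 <= n < N.+1) inner_sum s t n).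

Definition convergence_domain (R : realType) : set (R * R) :=
  interior [set p : R * R | 0 < p.1 /\ series_converges p.1 p.2].

(* Main.v *)
Require Import Defs.
From HB Require Import structures.
From mathcomp Require Import all_boot all_order all_algebra all_fingroup.
From mathcomp Require Import all_classical all_reals all_analysis.
From mathcomp Require Import complex.
From mathcomp Require Import ring lra zify polyXY.

Set Implicit Arguments.
Unset Strict Implicit.
Unset Printing Implicit Defensive.

Import Order.TTheory GRing.Theory Num.Theory.
Import numFieldNormedType.Exports.
Import ComplexField.Normc.

Local Open Scope classical_set_scope.
Local Open Scope ring_scope.

(** Put [b = tau / sigma] and [w = W_(-1)(- e^(b - 1))]. The [n]-th inner sum is
    homogeneous of degree [n], hence equal to [sigma^n p_n(b)] for a polynomial
    [p_n] ([lambert_poly n]). As [ln |w| + Re w = b - 1], the inequality of the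
    theorem says that [sigma |w| < 1]. So the point is that the growth rate of
    [|p_n(b)|] is exactly [|w|] when [b] is not 0. In the proofs [w] appears in
    polar form, [w = - K (cos h + i sin h)] with [K = |w|] and [h = - Im w]
    ([lambertWm1_polar]).

    The sum [v(s)] of [p_n(b) s^n] solves [e^(- v) = 1 + s (v - b)]. Critical
    points of this equation lie at [s = 1 / w] with [w e^w = - e^(b - 1)]; among
    these values the branch -1 (and its conjugate, when [b > 0]) gives the
    singularities that [v] really has closest to 0.

    Growth at most [|w|]. By the generating polynomial of the Stirling numbers,
    [p_n(b)] is the coefficient of [z^n] in [e^(b z) prod_(0 < j < n) (j - z)]
    ([lambert_polyE]), and Cauchy estimates apply to this entire function. If
    [b <= 0], all terms have the same sign and the crude bound on the circle is
    good enough ([lambert_growth_nonpos]). If [b > 0], the logarithm of the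
    modulus is a concave function of [Re z] on each circle [|z| = n r]; the
    tangent at the point [n zeta], where [zeta = 1 / (1 + w)] is a saddle
    point of [b z + int_0^1 ln (x - z) dx - ln z], bounds it on the circle by
    [n ln |w|] up to a constant ([lambert_growth_pos]). Both bounds persist, up
    to a factor close to 1 in the base, when [b] is replaced by a number close
    to it; this is what makes the points of convergence interior points.

    Growth at least [|w|] ([lambert_growth_sharp]). Otherwise [v] is analytic
    near the segment from 0 to [1 / w]. Taking imaginary parts in the functional
    equation shows that [h - Im v] cannot leave the interval from 0 to [pi]
    along the segment, which forces [v] to take the critical value at its end.
    There the differential equation [(1 + s + s (v - b)) v' = b - v] loses its
    leading coefficient, so that [v = b], whence [w = - 1] and [b = 0]. The
    differential equation is proved for the truncations of [v], up to terms of
    high order ([dvdXn_defect]); it comes from a linear partial differential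
    equation in [s] and [b], which is the recurrence of the Stirling numbers.

    For [tau = 0] the series vanishes, but the domain of convergence is an
    interior: close to [(sigma, 0)] with [sigma >= 1] there are points with
    [tau < 0] where the series diverges. *)

Local Notation "p ^:C" := (map_poly (real_complex _) p)
  (at level 2, format "p ^:C").

(** * Stirling cycle numbers *)

Local Open Scope set_scope.

Lemma card_porbits_lift_perm0 n (t : 'S_n) :
  #|porbits (lift_perm ord0 ord0 t)| = #|porbits t|.+1.
Proof.
have liftX i x : (lift_perm ord0 ord0 t ^+ i)%g (lift ord0 x) =
    lift ord0 ((t ^+ i)%g x).
  elim: i x => [|i IHi] x; first by rewrite !expg0 !perm1.
  by rewrite !expgS !permM lift_perm_lift IHi.
have fix0 i : (lift_perm ord0 ord0 t ^+ i)%g ord0 = ord0.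
  elim: i => [|i IHi]; first by rewrite expg0 perm1.
  by rewrite expgS permM lift_perm_id IHi.
have orbit0 : porbit (lift_perm ord0 ord0 t) ord0 = [set ord0].
  apply/setP=> y; rewrite inE; apply/porbitP/eqP => [[i ->]|->].
    by rewrite fix0.
  by exists 0%N; rewrite fix0.
have orbit_lift x : porbit (lift_perm ord0 ord0 t) (lift ord0 x) =
    [set lift ord0 y | y in porbit t x].
  apply/setP=> y; apply/porbitP/imsetP => [[i ->]|[z /porbitP[i ->] ->]].
    by exists ((t ^+ i)%g x); rewrite ?liftX ?mem_porbit.
  by exists i; rewrite liftX.
have -> : porbits (lift_perm ord0 ord0 t) =
    [set ord0] |: [set lift ord0 @: A | A : {set 'I_n} in porbits t].
  apply/setP=> A; rewrite !inE; apply/imsetP/orP => [[x _ ->]|].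
    case: (unliftP ord0 x) => [y ->|->]; last by left; rewrite orbit0.
    by right; rewrite orbit_lift; apply/imset_f/imset_f.
  case=> [/eqP->|/imsetP[B /imsetP[x _ ->] ->]].
    by exists ord0; rewrite ?orbit0.
  by exists (lift ord0 x); rewrite ?orbit_lift.
rewrite cardsU1 card_imset; last exact/imset_inj/lift_inj.
rewrite [_ \notin _](_ : _ = true) //; apply/imsetP => -[A _] /setP/(_ ord0).
rewrite inE eqxx => /esym/imsetP[x _ /eqP].
by rewrite (negPf (neq_lift _ _)).
Qed.

(** Every permutation of [n.+1] points is a permutation fixing the point 0
    preceded by the transposition of 0 with its preimage; the transposition
    merges the cycle of 0 into another one, unless it is trivial. *)
Lemma stirling_cycleSS n k :
  stirling_cycle n.+1 k.+1 = (stirling_cycle n k + n * stirling_cycle n k.+1)%N.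
Proof.
pose f (u : 'I_n.+1 * 'S_n) : 'S_n.+1 :=
  (tperm ord0 u.1 * lift_perm ord0 ord0 u.2)%g.
have fE u x : f u x = lift_perm ord0 ord0 u.2 (tperm ord0 u.1 x).
  exact: permM.
have f_inj : injective f.
  move=> [i s] [j t] /permP eq_f.
  have eq_ij : i = j.
    apply: (@perm_inj _ (f (j, t))); rewrite -eq_f !fE /= !tpermR.
    by rewrite !lift_perm_id.
  subst j; congr (_, _); apply/permP => x.
  apply: (@lift_inj _ ord0); rewrite -!(lift_perm_lift ord0 ord0).
  by have:= eq_f (tperm ord0 i (lift ord0 x)); rewrite !fE /= tpermK.
have f_bij : bijective f.
  apply: (inj_card_bij f_inj).
  by rewrite card_prod card_ord !card_Sn factS.
have card_f i s : #|porbits (f (i, s))| = (#|porbits s| + (i == ord0))%N.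
  have := porbits_mul_tperm (lift_perm ord0 ord0 s) ord0 i.
  rewrite /= card_porbits_lift_perm0 /f /= [ord0 == i]eq_sym.
  have [->|i_n0] := eqVneq i ord0.
    by rewrite porbit_id /= !addn0 addn1 => ->.
  suff -> : ord0 \notin porbit (lift_perm ord0 ord0 s) i.
    by move=> h; apply: (@addIn 2); rewrite addn0 [RHS]addn2 -[in RHS]addn1.
  rewrite porbit_sym; apply/porbitP => -[m im].
  case/eqP: i_n0; rewrite im; elim: m {im} => [|m IHm].
    by rewrite expg0 perm1.
  by rewrite expgS permM lift_perm_id.
rewrite /stirling_cycle -(on_card_preimset (f := f)); last first.
  by case: f_bij => g fK gK; exists g => x _.
rewrite (_ : f @^-1: _ = 
    finset.setX [set ord0] [set s | #|porbits s| == k]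
    :|: finset.setX [set~ ord0] [set s | #|porbits s| == k.+1]); last first.
  apply/setP=> -[i s]; rewrite !inE /= card_f.
  by case: (i == ord0); rewrite /= ?addn1 ?addn0 ?eqSS ?orbF.
rewrite cardsU !cardsX cards1 cardsC1 card_ord mul1n /=.
rewrite (_ : finset.setX _ _ :&: _ = finset.set0) ?cards0 ?subn0 //.
by apply/setP=> -[i s]; rewrite !inE /=; case: (i == ord0); rewrite /= ?andbF.
Qed.

Lemma stirling_cycle0n k : stirling_cycle 0 k = (k == 0%N).
Proof.
have p0 (s : 'S_0) : #|porbits s| = 0%N.
  apply/eqP; rewrite cards_eq0; apply/eqP/setP => A; rewrite inE.
  by apply/imsetP => -[[]].
rewrite /stirling_cycle; under eq_finset do rewrite p0 eq_sym.
case: eqP => _; last by apply: eq_card0 => s; rewrite inE.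
by rewrite cardsE card_Sn.
Qed.

Lemma stirling_cycleS0 n : stirling_cycle n.+1 0 = 0%N.
Proof.
apply: eq_card0 => s; rewrite inE; apply/negbTE; rewrite cards_eq0.
by apply/set0Pn; exists (porbit s ord0); apply: imset_f.
Qed.

Lemma stirling_cycle_gt n : stirling_cycle n n.+1 = 0%N.
Proof.
apply: eq_card0 => s; rewrite inE; apply/negbTE; rewrite neq_ltn ltnS.
by rewrite (leq_trans (leq_imset_card _ _)) // card_ord.
Qed.

(** The numbers [stirling_cycle n.+1 k] are the coefficients of the rising
    factorial [X (X + 1) ... (X + n)]; here [X] is cancelled and [X] becomes
    [- X]. *)
Lemma coef_prod_subX (R : comNzRingType) n i :
  (\prod_(1 <= j < n.+1) (j%:R%:P - 'X) : {poly R})`_i =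
  (- 1) ^+ i * (stirling_cycle n.+1 i.+1)%:R.
Proof.
elim: n i => [|n IHn] i.
  rewrite big_nil coef1 stirling_cycleSS !stirling_cycle0n /= mul0n addn0.
  by case: i => [|i]; rewrite ?mul1r ?mulr0.
rewrite big_nat_recr //= mulrBr coefB coefMC coefMX !IHn.
rewrite [in RHS]stirling_cycleSS.
case: i => [|i] /=.
  by rewrite stirling_cycleS0 subr0 add0n natrM; ring.
by rewrite natrD natrM exprS; ring.
Qed.

Local Close Scope set_scope.

(** * The homogeneous components of the series *)

Section LambertPoly.
Variable R : realType.

(** The component of degree [n] of the series, as a polynomial in
    [b = tau / sigma] (see [inner_sumE]). *)
Definition lambert_poly n : {poly R} :=
  \poly_(m < n.+1) (if m == 0%N then 0 else
    (- 1) ^+ (n - m) * (stirling_cycle n (n - m).+1)%:R / m`!%:R).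

Lemma lambert_poly0 : lambert_poly 0 = 0.
Proof. by apply/polyP=> i; rewrite coef_poly coef0; case: i. Qed.

Lemma lambert_poly_at0 n : (lambert_poly n).[0] = 0.
Proof. by rewrite horner_coef0 coef_poly. Qed.

Lemma lambert_poly1 : lambert_poly 1 = 'X.
Proof.
apply/polyP=> -[|[|i]]; rewrite coef_poly coefX //= subnn.
by rewrite !stirling_cycleSS !stirling_cycle0n expr0 mul1r /= divr1.
Qed.

(** The recurrence of the Stirling cycle numbers. In terms of the generating
    function [v(s, b)] of the [lambert_poly n] it reads
    [(1 + s) dv/db = s + s^2 dv/ds]. *)
Lemma lambert_poly_rec n :
  (lambert_poly n.+2)^`() =
  n.+1%:R * lambert_poly n.+1 - (lambert_poly n.+1)^`().
Proof.
have factE (c : R) i : c / i.+1`!%:R *+ i.+1 = c / i`!%:R.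
  rewrite factS natrM -mulr_natr; field.
  by rewrite nat1r !pnatr_eq0 -!lt0n fact_gt0.
apply/polyP=> i; rewrite coefB !coef_deriv -polyC_natr coefCM !coef_poly /=.
case: (ltngtP i n.+1) => [lt_in|gt_in|->].
- have -> : (i < n.+2)%N by lia.
  have -> : (i.+1 < n.+3)%N by lia.
  have -> : (i.+1 < n.+2)%N by lia.
  rewrite !factE !subSS.
  case: i lt_in => [|i] lt_in /=.
    rewrite !subn0 [stirling_cycle n.+2 _](_ : _ =
      stirling_cycle n.+1 n.+1 + n.+1 * stirling_cycle n.+1 n.+2)%N;
      last exact: stirling_cycleSS.
    by rewrite mulr0 sub0r stirling_cycle_gt muln0 addn0 exprS; ring.
  have -> : (n.+1 - i.+1 = (n - i.+1).+1)%N by lia.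
  rewrite stirling_cycleSS exprS natrD natrM.
  by field; rewrite pnatr_eq0 -lt0n fact_gt0.
- by rewrite !ifN ?mul0rn ?mulr0 ?subr0 //; lia.
- rewrite !ltnSn ltnn mul0rn subr0 factE !subnn.
  by rewrite stirling_cycleSS stirling_cycleS0 add0n natrM /=; ring.
Qed.

End LambertPoly.

(** * The differential equation of the generating function *)

Section CoefDerivation.
Variable R : comNzRingType.
Implicit Types P Q : {poly {poly R}}.

(** Coefficientwise derivative. Defined through the exchange of the two
    variables, it inherits the product rule from that of [deriv]. *)
Definition dcoef P : {poly {poly R}} := swapXY (swapXY P)^`().
Local Notation "P ^b" := (dcoef P) (at level 2, format "P ^b").

Lemma coef_dcoef P i : P^b`_i = (P`_i)^`().
Proof.
by apply/polyP=> j; rewrite coef_swapXY !coef_deriv coefMn coef_swapXY.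
Qed.

Lemma dcoefD P Q : (P + Q)^b = P^b + Q^b.
Proof. by rewrite /dcoef (raddfD (@swapXY R)) derivD raddfD. Qed.

Lemma dcoefB P Q : (P - Q)^b = P^b - Q^b.
Proof. by rewrite /dcoef (raddfB (@swapXY R)) derivB raddfB. Qed.

Lemma dcoefM P Q : (P * Q)^b = P^b * Q + P * Q^b.
Proof.
have swapM := rmorphM (@swapXY R); rewrite /= in swapM.
by rewrite /dcoef swapM derivM (raddfD (@swapXY R)) /= !swapM !swapXYK.
Qed.

Lemma dcoefXn n : ('X^n : {poly {poly R}})^b = 0.
Proof.
apply/polyP=> i; rewrite coef_dcoef coefXn coef0.
by rewrite -polyC_natr derivC.
Qed.

Lemma dcoefX : ('X : {poly {poly R}})^b = 0.
Proof. exact: (dcoefXn 1). Qed.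

Lemma dcoefC (p : {poly R}) : (p%:P)^b = (p^`())%:P.
Proof.
apply/polyP=> i; rewrite coef_dcoef !coefC.
by case: eqP => // _; rewrite deriv0.
Qed.

Lemma dcoef_deriv P : (P^`())^b = (P^b)^`().
Proof.
apply/polyP=> i; rewrite coef_deriv !coef_dcoef coef_deriv derivMn.
by [].
Qed.

End CoefDerivation.

Section FunctionalEquation.
Variable R : realType.
Local Notation "P ^b" := (dcoef P) (at level 2, format "P ^b").

Definition lambert_trunc N : {poly {poly R}} :=
  \poly_(n < N.+1) lambert_poly R n.

Lemma lambert_truncS N :
  lambert_trunc N.+1 = lambert_trunc N + (lambert_poly R N.+1)%:P * 'X^(N.+1).
Proof. by rewrite /lambert_trunc !poly_def big_ord_recr /= mul_polyC. Qed.

(** The transport equation [(1 + s) dv/db = s + s^2 dv/ds], where [s] is the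
    outer variable ['X] and [b] the inner one. *)
Lemma lambert_trunc_transport N : exists e : {poly {poly R}},
  (1 + 'X) * (lambert_trunc N.+1)^b =
  'X + 'X^2 * (lambert_trunc N.+1)^`() + 'X^(N.+2) * e.
Proof.
suff H : (1 + 'X) * (lambert_trunc N.+1)^b =
    'X + 'X^2 * (lambert_trunc N.+1)^`() + 'X^(N.+2) *
      ((lambert_poly R N.+1)^`() - N.+1%:R * lambert_poly R N.+1)%:P.
  by eexists; apply: H.
elim: N => [|N IHN].
  have -> : lambert_trunc 1 = 'X%:P * 'X.
    rewrite lambert_truncS /lambert_trunc poly_def big_ord_recl big_ord0 /=.
    by rewrite lambert_poly0 scale0r !add0r lambert_poly1 expr1.
  rewrite dcoefM dcoefC dcoefX lambert_poly1.
  rewrite derivM derivC !derivX.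
  by rewrite polyCB polyCM !polyC1; ring.
rewrite lambert_truncS dcoefD mulrDr IHN dcoefM.
rewrite dcoefXn dcoefC.
rewrite derivD derivM derivC derivXn mul0r add0r /=.
have eP : (lambert_poly R N.+2)^`()%:P =
    N.+1%:R * (lambert_poly R N.+1)%:P - ((lambert_poly R N.+1)^`())%:P
    :> {poly {poly R}}.
  by rewrite lambert_poly_rec polyCB polyCM polyC_natr.
rewrite !polyCB !polyCM !polyC_natr !eP -mulr_natr !exprS.
ring.
Qed.

(** With [U = 1 + s (V - b)], the derivative of [U exp V] with respect to [s]
    is [defect b V * exp V]. *)
Definition defect (b : R) (V : {poly R}) : {poly R} :=
  (1 + 'X * (V - b%:P))^`() + V^`() * (1 + 'X * (V - b%:P)).

Lemma deriv_eq0_at0 (p : {poly R}) : p^`() = 0 -> p.[0] = 0 -> p = 0.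
Proof.
move=> dp p0; apply/polyP=> -[|i]; rewrite coef0.
  by rewrite -horner_coef0.
have /eqP := congr1 (fun q : {poly R} => q`_i) dp.
by rewrite coef_deriv coef0 mulrn_eq0 /= => /eqP.
Qed.

(** For the full series [v], the operator [L = (1 + s) d/db - s^2 d/ds] maps [v]
    to [s] and [U] to [- s U]; commuting it with [d/ds] shows that
    [T = U' + v' U] satisfies [(1 + s) L T = s T]. This equation expresses the
    [b]-derivative of each coefficient of [T] by lower coefficients and their
    [b]-derivatives, and [T] vanishes at [b = 0]; hence [T = 0] by induction.
    For the truncations the same computation holds modulo a power of [s]. *)
Lemma dvdXn_defect (b : R) N : exists G : {poly R},
  defect b (\poly_(n < N.+2) (lambert_poly R n).[b]) = 'X^(N.+1) * G.
Proof.
pose V := lambert_trunc N.+1.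
have [W defW] : exists W : {poly {poly R}}, W = V - 'X%:P by eexists.
pose T := (1 + 'X * W)^`() + V^`() * (1 + 'X * W).
suff [G TG] : exists G : {poly {poly R}}, T = 'X^(N.+1) * G.
  exists (map_poly (horner_eval b) G).
  have VE :
      \poly_(n < N.+2) (lambert_poly R n).[b] = map_poly (horner_eval b) V.
    by apply/polyP=> i; rewrite coef_map !coef_poly /=; case: ifP => _;
      rewrite /horner_eval ?horner0.
  rewrite /defect VE.
  have -> : b%:P = map_poly (horner_eval b) ('X%:P).
    by rewrite map_polyC /= /horner_eval hornerX.
  have -> : 'X^(N.+1) * map_poly (horner_eval b) G =
      map_poly (horner_eval b) T by rewrite TG rmorphM /= map_polyXn.
  have evD := raddfD (map_poly (horner_eval b)).
  have evB := raddfB (map_poly (horner_eval b)).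
  have evM := rmorphM (map_poly (horner_eval b)).
  rewrite /= in evD evB evM.
  set phi := map_poly (horner_eval b) in evD evB evM *.
  have dphi P : phi P^`() = (phi P)^`() by rewrite /phi deriv_map.
  have phi1 : phi 1 = 1 by exact: rmorph1.
  have phiX : phi 'X = 'X by exact: map_polyX.
  by rewrite /T defW evD evM !dphi evD evM evB phi1 phiX.
have [e Ve] : exists e, (1 + 'X) * V^b = 'X + 'X^2 * V^`() + 'X^(N.+2) * e.
  exact: lambert_trunc_transport.
have d1 : (1 : {poly {poly R}})^`() = 0 by rewrite -polyC1 derivC.
have b1 : (1 : {poly {poly R}})^b = 0.
  by rewrite -polyC1 dcoefC derivC polyC0.
have dVe : (1 + 'X) * (V^b)^`() =
    1 + 2%:R * 'X * V^`() + 'X^2 * V^`()^`() + N.+2%:R * 'X^(N.+1) * e +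
    'X^(N.+2) * e^`() - V^b.
  have dL : ((1 + 'X) * V^b)^`() = V^b + (1 + 'X) * (V^b)^`().
    by rewrite derivM derivD d1 derivX add0r mul1r.
  have dR : ('X + 'X^2 * V^`() + 'X^(N.+2) * e)^`() =
      1 + (2%:R * 'X * V^`() + 'X^2 * V^`()^`()) +
      (N.+2%:R * 'X^(N.+1) * e + 'X^(N.+2) * e^`()).
    rewrite !derivD derivX [('X^2 * _)^`()]derivM [(_ * e)^`()]derivM.
    by rewrite !derivXn /= -(mulr_natl 'X) -(mulr_natl 'X^(N.+1)).
  apply: (addrI V^b); rewrite -dL Ve dR; ring.
have WE : W^b = V^b - 1.
  by rewrite defW dcoefB dcoefC derivX polyC1.
have dW : W^`() = V^`() by rewrite defW derivB derivC subr0.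
have UE : (1 + 'X * W)^`() = W + 'X * V^`().
  by rewrite derivD derivM derivX dW d1 add0r mul1r.
have TE : T = W + 'X * V^`() + V^`() * (1 + 'X * W) by rewrite /T UE.
(* the equation [(1 + s) L T = s T], modulo a power of [s] *)
have [F eqT] : exists F, (1 + 'X) ^+ 2 * T^b =
    'X^2 * (1 + 'X) * T^`() + 'X * T + 'X^(N.+1) * F.
  exists ((1 + 'X) * 'X * e * (1 + 'X * V^`()) +
    ((1 + 'X) * (N.+2%:R * e + 'X * e^`()) - 'X * e) * ('X + (1 + 'X * W))).
  have -> : T^`() = V^`() + (V^`() + 'X * V^`()^`()) +
      (V^`()^`() * (1 + 'X * W) + V^`() * (W + 'X * V^`())).
    by rewrite TE derivD derivD derivM derivM UE derivX dW mul1r.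
  have -> : T^b = (V^b - 1) + 'X * (V^b)^`() +
      ((V^b)^`() * (1 + 'X * W) + V^`() * ('X * (V^b - 1))).
    rewrite TE !dcoefD !dcoefM dcoefD.
    rewrite dcoefM dcoefX WE dcoef_deriv.
    by rewrite b1 !mul0r !add0r.
  rewrite TE.
  transitivity ((1 + 'X) * ((1 + 'X) * V^b) * (1 + 'X * V^`()) +
    (1 + 'X) * ((1 + 'X) * (V^b)^`()) * ('X + (1 + 'X * W)) -
    (1 + 'X) ^+ 2 * (1 + 'X * V^`())); first by ring.
  rewrite dVe.
  transitivity ((1 + 'X) * ((1 + 'X) * V^b) * (1 + 'X * V^`()) +
    ((1 + 'X) * (1 + 2%:R * 'X * V^`() + 'X^2 * V^`()^`() +
      N.+2%:R * 'X^(N.+1) * e + 'X^(N.+2) * e^`()) - (1 + 'X) * V^b)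
      * ('X + (1 + 'X * W)) -
    (1 + 'X) ^+ 2 * (1 + 'X * V^`())); first by ring.
  rewrite Ve !exprS.
  ring.
have T0 : map_poly (horner_eval 0) T = 0.
  have V0 : map_poly (horner_eval 0) V = 0.
    apply/polyP=> i; rewrite coef_map coef_poly coef0 /=; case: ifP => _.
      exact: lambert_poly_at0.
    exact: horner0.
  have evD := raddfD (map_poly (horner_eval (0 : R))).
  have evM := rmorphM (map_poly (horner_eval (0 : R))).
  rewrite /= in evD evM.
  have W0 : map_poly (horner_eval 0) W = 0.
    by rewrite defW raddfB /= V0 map_polyC /= /horner_eval hornerX subr0.
  by rewrite TE !evD !evM -deriv_map V0 W0 deriv0 mulr0 mul0r !addr0.
suff H k : (k <= N.+1)%N -> exists G, T = 'X^k * G by apply: H.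
elim: k => [_|k IHk lt_kN]; first by exists T; rewrite mul1r.
have [G TG] := IHk (ltnW lt_kN).
(* it is enough that the constant term of [G], a polynomial in [b], vanishes *)
suff G0 : G`_0 = 0.
  have /factor_theorem[G1 G1E] : root G 0 by rewrite /root horner_coef0 G0.
  by exists G1; rewrite TG G1E subr0 exprSr mulrAC mulrA.
apply: deriv_eq0_at0; last first.
  have /eqP := T0; rewrite TG rmorphM /= map_polyXn mulf_eq0 expf_eq0.
  rewrite polyX_eq0 andbF /= => /eqP/(congr1 (fun p : {poly R} => p`_0)).
  by rewrite coef_map coef0.
have : 'X^k * ((1 + 'X) ^+ 2 * G^b) = 'X^k *
    ('X * ((1 + 'X) * (k%:R * G + 'X * G^`()) + G + 'X^(N - k) * F)).
  have := eqT; rewrite {1}TG dcoefM dcoefXn mul0r add0r.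
  rewrite mulrCA => ->; rewrite TG derivM derivXn -mulr_natl.
  have -> : 'X^(N.+1) = 'X^k * ('X * 'X^(N - k)) :> {poly {poly R}}.
    by rewrite -exprS -exprD; congr ('X^_); lia.
  case: k {lt_kN IHk TG} => [|k]; first by ring.
  by rewrite /= !exprS; ring.
move=> /(mulfI _) eqG; have {eqG} := eqG _.
rewrite expf_eq0 polyX_eq0 andbF => /(_ isT).
move=> /(congr1 (fun p : {poly {poly R}} => p`_0)).
rewrite !coefXM coef0M -coef_dcoef => /=.
rewrite expr2 coef0M coefD coef1 coefX addr0 !mul1r.
by [].
Qed.

End FunctionalEquation.

(** * Majorants of polynomials *)

Section Majorant.
Variable R : realType.
Implicit Types (p q : {poly R}) (r : R) (z : R[i]).

Lemma normc_le_ReIm z : normc z <= `|complex.Re z| + `|complex.Im z|.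
Proof.
case: z => x y.
rewrite (_ : Complex x y = Complex x 0 + Complex 0 y); last first.
  by apply/eqP; rewrite eq_complex /= addr0 add0r !eqxx.
apply: le_trans (le_normcD _ _) _.
by rewrite /normc /= expr0n /= addr0 add0r !sqrtr_sqr add0r addr0.
Qed.

Lemma normc_ge_Re z : `|complex.Re z| <= normc z.
Proof. by have := complex.normc_ge_Re z; rewrite lecR. Qed.

Lemma normc_ge_Im z : `|complex.Im z| <= normc z.
Proof.
case: z => x y /=; rewrite -sqrtr_sqr ler_sqrt ?addr_ge0 ?sqr_ge0 //.
by rewrite lerDr sqr_ge0.
Qed.

Lemma normcX z n : normc (z ^+ n) = normc z ^+ n.
Proof. by elim: n => [|n IHn]; rewrite ?expr0 ?normc1 // !exprS normcM IHn. Qed.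

Definition majorant_poly p : {poly R} := \poly_(i < size p) `|p`_i|.

Definition majorant r p := (majorant_poly p).[r].

Lemma coef_majorant_poly p i : (majorant_poly p)`_i = `|p`_i|.
Proof.
rewrite coef_poly; case: ltnP => // /(nth_default 0) ->.
by rewrite normr0.
Qed.

Lemma ler_horner p q r : 0 <= r -> (forall i, p`_i <= q`_i) -> p.[r] <= q.[r].
Proof.
move=> r0 le_pq; pose n := maxn (size p) (size q).
rewrite (@horner_coef_wide _ n p) ?leq_maxl //.
rewrite (@horner_coef_wide _ n q) ?leq_maxr //.
by apply: ler_sum => i _; rewrite ler_wpM2r ?exprn_ge0.
Qed.

Lemma majorant_ge0 r p : 0 <= r -> 0 <= majorant r p.
Proof.
move=> r0; rewrite -(horner0 r) ler_horner // => i.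
by rewrite coef0 coef_majorant_poly.
Qed.

Lemma le_majorant r r' p : 0 <= r <= r' -> majorant r p <= majorant r' p.
Proof.
move=> /andP[r0 rr']; rewrite /majorant !horner_coef; apply: ler_sum => i _.
by rewrite ler_wpM2l ?coef_majorant_poly // lerXn2r ?nnegrE // (le_trans r0).
Qed.

Lemma majorantD r p q : 0 <= r ->
  majorant r (p + q) <= majorant r p + majorant r q.
Proof.
move=> r0; rewrite -hornerD ler_horner // => i.
by rewrite coefD !coef_majorant_poly coefD ler_normD.
Qed.

Lemma majorantM r p q : 0 <= r ->
  majorant r (p * q) <= majorant r p * majorant r q.
Proof.
move=> r0; rewrite -hornerM ler_horner // => i.
rewrite coef_majorant_poly !coefM (le_trans (ler_norm_sum _ _ _)) //.
by apply: ler_sum => j _; rewrite !coef_majorant_poly normrM.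
Qed.

Lemma majorantC r c : majorant r c%:P = `|c|.
Proof.
rewrite /majorant (_ : majorant_poly _ = `|c|%:P) ?hornerC //.
apply/polyP=> i; rewrite coef_majorant_poly !coefC.
by case: eqP; rewrite ?normr0.
Qed.

Lemma majorantXnM r n p : majorant r ('X^n * p) = r ^+ n * majorant r p.
Proof.
rewrite /majorant (_ : majorant_poly _ = 'X^n * majorant_poly p).
  by rewrite hornerM hornerXn.
apply/polyP=> i; rewrite coef_majorant_poly !coefXnM coef_majorant_poly.
by case: ifP; rewrite ?normr0.
Qed.

(** Since [(i + 1) r^i (r' - r) <= r'^(i + 1)]: the Cauchy estimate of the
    derivative, for majorants. *)
Lemma majorant_deriv r r' p : 0 <= r < r' ->
  majorant r p^`() <= majorant r' p / (r' - r).
Proof.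
move=> /andP[r0 rr']; have r'0 : 0 <= r' by rewrite (le_trans r0) // ltW.
rewrite ler_pdivlMr ?subr_gt0 //.
have -> : majorant r p^`() = (majorant_poly p)^`().[r].
  congr (_.[r]); apply/polyP=> i.
  by rewrite coef_majorant_poly !coef_deriv coef_majorant_poly normrMn.
rewrite /majorant; move: (majorant_poly p) (coef_majorant_poly p) => q qE.
have q0 i : 0 <= q`_i by rewrite qE.
rewrite (@horner_coef_wide _ (size q) q^`()); last first.
  by apply/leq_sizeP => i lti; rewrite coef_deriv nth_default ?mul0rn // ltnW.
rewrite (@horner_coef_wide _ (size q).+1 q) // [leRHS]big_ord_recl.
rewrite mulr_suml ler_wpDl ?mulr_ge0 ?exprn_ge0 //.
apply: ler_sum => i _; rewrite coef_deriv /= /bump /= add1n.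
rewrite -mulr_natr -!mulrA ler_wpM2l //.
have: (r' - r) * \sum_(j < i.+1) r' ^+ (i - j) * r ^+ j <= r' ^+ i.+1.
  by rewrite -subrXX lerBlDr lerDl exprn_ge0.
apply: le_trans; rewrite mulrA mulrC ler_pM2l ?subr_gt0 //.
have -> : i.+1%:R * r ^+ i = \sum_(j < i.+1) r ^+ (i - j + j).
  rewrite mulr_natl -[X in _ *+ X = _](card_ord i.+1) -sumr_const.
  by apply: eq_bigr => j _; rewrite subnK // -ltnS.
apply: ler_sum => j _.
by rewrite exprD ler_wpM2r ?exprn_ge0 // lerXn2r ?nnegrE // ltW.
Qed.


Lemma normc_horner r p z : normc z <= r -> normc p^:C.[z] <= majorant r p.
Proof.
move=> le_zr; rewrite -lecR -[(normc _)%:C%C]/(`|p^:C.[z]|).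
rewrite (@horner_coef_wide _ (size p)) ?size_map_poly //.
apply: le_trans (ler_norm_sum _ _ _) _.
rewrite /majorant (@horner_coef_wide _ (size p)) ?size_poly //.
rewrite (@big_morph _ _ (real_complex R) 0 +%R) //; last first.
  by move=> x y; rewrite rmorphD.
apply: ler_sum => i _; rewrite normrM normrX coef_map coef_majorant_poly /=.
have -> : `|(real_complex R) p`_i| = (`|p`_i|)%:C%C.
  by rewrite normc_def /= expr0n addr0 sqrtr_sqr.
rewrite rmorphM rmorphXn /= ler_wpM2l ?lecR //.
have le_zrC : `|z| <= r%:C%C by rewrite lecR.
by rewrite lerXn2r ?nnegrE ?normr_ge0 // (le_trans _ le_zrC).
Qed.

End Majorant.

(** * Power series along a segment of the complex plane *)

Section ComplexParts.
Variable R : realType.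
Implicit Types F G : {poly R[i]}.

Definition re_poly F : {poly R} := \poly_(i < size F) complex.Re F`_i.
Definition im_poly F : {poly R} := \poly_(i < size F) complex.Im F`_i.

Lemma ReD (z w : R[i]) : complex.Re (z + w) = complex.Re z + complex.Re w.
Proof. by case: z w => [? ?] [? ?]. Qed.
Lemma ImD (z w : R[i]) : complex.Im (z + w) = complex.Im z + complex.Im w.
Proof. by case: z w => [? ?] [? ?]. Qed.
Lemma ReM (z w : R[i]) : complex.Re (z * w) =
  complex.Re z * complex.Re w - complex.Im z * complex.Im w.
Proof. by case: z w => [? ?] [? ?]. Qed.
Lemma ImM (z w : R[i]) : complex.Im (z * w) =
  complex.Re z * complex.Im w + complex.Im z * complex.Re w.
Proof. by case: z w => [? ?] [? ?]. Qed.

Lemma ReMn (z : R[i]) n : complex.Re (z *+ n) = complex.Re z *+ n.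
Proof. by elim: n => [|n IHn] //; rewrite !mulrSr ReD IHn. Qed.
Lemma ImMn (z : R[i]) n : complex.Im (z *+ n) = complex.Im z *+ n.
Proof. by elim: n => [|n IHn] //; rewrite !mulrSr ImD IHn. Qed.

Lemma Re_sum n (f : 'I_n -> R[i]) :
  complex.Re (\sum_(i < n) f i) = \sum_(i < n) complex.Re (f i).
Proof. exact: (big_morph _ ReD). Qed.
Lemma Im_sum n (f : 'I_n -> R[i]) :
  complex.Im (\sum_(i < n) f i) = \sum_(i < n) complex.Im (f i).
Proof. exact: (big_morph _ ImD). Qed.

Lemma coef_re_poly F i : (re_poly F)`_i = complex.Re F`_i.
Proof. by rewrite coef_poly; case: ltnP => // /(nth_default 0) ->. Qed.
Lemma coef_im_poly F i : (im_poly F)`_i = complex.Im F`_i.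
Proof. by rewrite coef_poly; case: ltnP => // /(nth_default 0) ->. Qed.

Lemma re_polyD F G : re_poly (F + G) = re_poly F + re_poly G.
Proof. by apply/polyP=> i; rewrite coefD !coef_re_poly coefD ReD. Qed.
Lemma im_polyD F G : im_poly (F + G) = im_poly F + im_poly G.
Proof. by apply/polyP=> i; rewrite coefD !coef_im_poly coefD ImD. Qed.

Lemma re_polyM F G :
  re_poly (F * G) = re_poly F * re_poly G - im_poly F * im_poly G.
Proof.
apply/polyP=> i; rewrite coefB coef_re_poly !coefM Re_sum -sumrB.
by apply: eq_bigr => j _; rewrite ReM !coef_re_poly !coef_im_poly.
Qed.
Lemma im_polyM F G :
  im_poly (F * G) = re_poly F * im_poly G + im_poly F * re_poly G.
Proof.
apply/polyP=> i; rewrite coefD coef_im_poly !coefM Im_sum -big_split /=.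
by apply: eq_bigr => j _; rewrite ImM !coef_re_poly !coef_im_poly.
Qed.

Lemma re_poly_deriv F : re_poly F^`() = (re_poly F)^`().
Proof.
apply/polyP=> i; rewrite coef_deriv !coef_re_poly coef_deriv.
by rewrite ReMn.
Qed.
Lemma im_poly_deriv F : im_poly F^`() = (im_poly F)^`().
Proof.
apply/polyP=> i; rewrite coef_deriv !coef_im_poly coef_deriv.
by rewrite ImMn.
Qed.

Lemma horner_re_poly F (x : R) : (re_poly F).[x] = complex.Re F.[x%:C%C].
Proof.
rewrite (@horner_coef_wide _ (size F)) ?size_poly // horner_coef Re_sum.
apply: eq_bigr => i _; rewrite coef_re_poly -rmorphXn ReM /=.
by rewrite mulr0 subr0.
Qed.
Lemma horner_im_poly F (x : R) : (im_poly F).[x] = complex.Im F.[x%:C%C].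
Proof.
rewrite (@horner_coef_wide _ (size F)) ?size_poly // horner_coef Im_sum.
apply: eq_bigr => i _; rewrite coef_im_poly -rmorphXn ImM /=.
by rewrite mulr0 add0r.
Qed.

(** The derivative of [A exp P] is [(A' + P' A) exp P]; the mean value theorem
    is applied to its real and imaginary parts. *)
Lemma expC_drift (P A : {poly R[i]}) (M d : R) :
  (forall x : R, 0 <= x <= 1 -> normc P.[x%:C%C] <= M) ->
  (forall x : R, 0 <= x <= 1 -> normc (A^`() + P^`() * A).[x%:C%C] <= d) ->
  forall x : R, 0 <= x <= 1 ->
  let E t := A.[t%:C%C] * expC P.[t%:C%C] in
  `|complex.Re (E x) - complex.Re (E 0)| <= expR M * (d + d) /\
  `|complex.Im (E x) - complex.Im (E 0)| <= expR M * (d + d).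
Proof.
move=> PM Ad x x01 E.
pose p := re_poly P; pose q := im_poly P.
pose u := re_poly A; pose v := im_poly A.
pose f := re_poly (A^`() + P^`() * A); pose g := im_poly (A^`() + P^`() * A).
have fE : f = u^`() + p^`() * u - q^`() * v.
  by rewrite /f re_polyD re_polyM !re_poly_deriv im_poly_deriv addrA.
have gE : g = v^`() + p^`() * v + q^`() * u.
  by rewrite /g im_polyD im_polyM !im_poly_deriv re_poly_deriv addrA.
have ReE t : complex.Re (E t) =
    expR p.[t] * (u.[t] * cos q.[t] - v.[t] * sin q.[t]).
  by rewrite /E ReM /= !horner_re_poly !horner_im_poly; ring.
have ImE t : complex.Im (E t) =
    expR p.[t] * (u.[t] * sin q.[t] + v.[t] * cos q.[t]).
  by rewrite /E ImM /= !horner_re_poly !horner_im_poly; ring.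
have pM (t : R) : 0 <= t <= 1 -> expR p.[t] <= expR M.
  move=> t01; rewrite ler_expR horner_re_poly (le_trans (ler_norm _)) //.
  exact: le_trans (normc_ge_Re _) (PM _ t01).
have fd (t : R) : 0 <= t <= 1 -> `|f.[t]| <= d.
  move=> t01; rewrite horner_re_poly.
  exact: le_trans (normc_ge_Re _) (Ad _ t01).
have gd (t : R) : 0 <= t <= 1 -> `|g.[t]| <= d.
  move=> t01; rewrite horner_im_poly.
  exact: le_trans (normc_ge_Im _) (Ad _ t01).
have bound (h dh : R -> R) : (forall t : R, is_derive t (1 : R) h (dh t)) ->
    (forall t : R, 0 <= t <= 1 -> `|dh t| <= expR M * (d + d)) ->
    `|h x - h 0| <= expR M * (d + d).
  move=> hd dhM; have [x0 x1] := andP x01.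
  have hd' (t : R) : t \in `]0, x[%R -> is_derive t (1 : R) h (dh t) by [].
  have hc : {within `[0, x], continuous h}.
    by apply: derivable_within_continuous => t _; have [] := hd t.
  have [t] := MVT_segment x0 hd' hc.
  rewrite in_itv /= => /andP[t0 tx] ->.
  have t01 : 0 <= t <= 1 by rewrite t0 (le_trans tx).
  rewrite normrM -[leRHS]mulr1 ler_pM // ?dhM // subr0 ger0_norm //.
have trig (t c c' : R) : 0 <= t <= 1 -> `|c| <= 1 -> `|c'| <= 1 ->
    `|expR p.[t] * (f.[t] * c + g.[t] * c')| <= expR M * (d + d).
  move=> t01 c1 c'1; rewrite normrM ler_pM //.
    by rewrite ger0_norm ?expR_ge0 ?pM.
  rewrite (le_trans (ler_normD _ _)) // !normrM lerD //.
    by rewrite -[leRHS]mulr1 ler_pM ?fd.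
  by rewrite -[leRHS]mulr1 ler_pM ?gd.
rewrite !ReE !ImE; split.
- apply: (bound (fun t => expR p.[t] * (u.[t] * cos q.[t] - v.[t] * sin q.[t]))
   (fun t => expR p.[t] * (f.[t] * cos q.[t] + g.[t] * - sin q.[t]))) => t.
    apply: is_derive_eq; rewrite fE gE !hornerE /GRing.scale /=; ring.
  by move=> t01; apply: trig => //; rewrite ?normrN ?cos_max ?sin_max.
- apply: (bound (fun t => expR p.[t] * (u.[t] * sin q.[t] + v.[t] * cos q.[t]))
   (fun t => expR p.[t] * (f.[t] * sin q.[t] + g.[t] * cos q.[t]))) => t.
    apply: is_derive_eq; rewrite fE gE !hornerE /GRing.scale /=; ring.
  by move=> t01; apply: trig => //; rewrite ?cos_max ?sin_max.
Qed.

End ComplexParts.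

Section PowerSeriesOnUnitInterval.
Variable R : realType.

Lemma cvgn_dist_le (u v : nat -> R) (l : R) :
  (forall n, `|u n - l| <= v n) -> v @ \oo --> (0 : R) -> u @ \oo --> l.
Proof.
move=> uv v0; apply/cvgrPdist_le => e e0.
move/cvgrPdist_le/(_ _ e0) : v0; apply: filterS => n.
rewrite sub0r normrN distrC => /(le_trans (ler_norm _)).
exact: le_trans (uv n).
Qed.

Lemma norm_horner_majorant (p : {poly R}) (x r : R) :
  `|x| <= r -> `|p.[x]| <= majorant r p.
Proof.
move=> xr; have r0 : 0 <= r by apply: le_trans xr.
rewrite horner_coef (le_trans (ler_norm_sum _ _ _)) //.
rewrite /majorant (@horner_coef_wide _ (size p)) ?size_poly //.
apply: ler_sum => i _; rewrite coef_majorant_poly normrM normrX.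
by rewrite ler_wpM2l // lerXn2r ?nnegrE.
Qed.

Lemma horner_lipschitz (p : {poly R}) (q x y : R) : 1 < q ->
  0 <= x <= 1 -> 0 <= y <= 1 ->
  `|p.[x] - p.[y]| <= majorant q p / (q - 1) * `|x - y|.
Proof.
move=> q1; wlog xy : x y / y <= x.
  move=> H x01 y01; have [|/ltW] := leP y x; first by move=> ?; apply: H.
  by move=> ?; rewrite distrC [`|x - y|]distrC; apply: H.
move=> /andP[x0 x1] /andP[y0 y1].
have hd (t : R) : t \in `]y, x[%R ->
    is_derive t (1 : R) (fun t => p.[t]) p^`().[t].
  by move=> _; exact: is_derive_poly.
have hc : {within `[y, x], continuous (fun t => p.[t])}.
  by apply: derivable_within_continuous => t _; exact: derivable_horner.
have [t] := MVT_segment xy hd hc; rewrite in_itv /= => /andP[yt tx] ->.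
rewrite normrM ler_wpM2r //; have t1 : `|t| <= 1.
  by rewrite ger0_norm ?(le_trans y0) // (le_trans tx).
rewrite (le_trans (norm_horner_majorant _ t1)) //.
by apply: majorant_deriv; rewrite ler01.
Qed.

Section Limit.
Variables (c : nat -> R) (q M : R).
Hypotheses (q1 : 1 < q) (cM : forall N, majorant q (\poly_(n < N) c n) <= M).

Lemma cvgn_poly_trunc x : 0 <= x <= 1 ->
  cvgn (fun N => (\poly_(n < N) c n).[x]).
Proof.
move=> /andP[x0 x1]; have q0 : 0 <= q by rewrite ltW // (lt_trans ltr01).
have -> : (fun N => (\poly_(n < N) c n).[x]) = series (fun n => c n * x ^+ n).
  by apply/funext => N; rewrite horner_poly seriesEord.
apply: normed_cvg; apply: (@series_le_cvg _ _ (fun n => `|c n| * q ^+ n)).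
- by move=> n; rewrite normr_ge0.
- by move=> n; rewrite mulr_ge0 ?exprn_ge0.
- move=> n /=; rewrite normrM normrX ler_wpM2l // lerXn2r ?nnegrE //.
  by rewrite ger0_norm // (le_trans x1) // ltW.
apply: nondecreasing_is_cvgn.
  by apply: nondecreasing_series => n _ _; rewrite mulr_ge0 ?exprn_ge0.
exists M => _ [N _ <-]; apply: le_trans (cM N).
rewrite seriesEord /majorant (@horner_coef_wide _ N); last first.
  by rewrite (leq_trans (size_poly _ _)) // size_poly.
apply: ler_sum => i _.
by rewrite coef_majorant_poly coef_poly ltn_ord.
Qed.

(** The truncations are Lipschitz with a common constant, by
    [majorant_deriv]. *)
Lemma continuous_lim_poly_trunc :
  {within `[0, 1],
    continuous (fun x => limn (fun N => (\poly_(n < N) c n).[x]))}.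
Proof.
pose f (x : R) := limn (fun N => (\poly_(n < N) c n).[x]).
change ({within `[0, 1], continuous f}).
have fc (x : R) : 0 <= x <= 1 ->
    (fun N => (\poly_(n < N) c n).[x]) @ \oo --> f x.
  by move=> /cvgn_poly_trunc.
have M0 : 0 <= M.
  by apply: le_trans (cM 0); rewrite majorant_ge0 // ltW // (lt_trans ltr01).
have q10 : 0 < q - 1 by rewrite subr_gt0.
have flip (x y : R) : 0 <= x <= 1 -> 0 <= y <= 1 ->
    `|f x - f y| <= M / (q - 1) * `|x - y|.
  move=> x01 y01; have cv :
      (fun N => `|(\poly_(n < N) c n).[x] - (\poly_(n < N) c n).[y]|) @ \oo
      --> `|f x - f y|.
    by apply: cvg_norm; apply: cvgB; apply: fc.
  have <- := cvg_lim (@Rhausdorff R) cv.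
  apply: limr_le; first by apply/cvg_ex; eexists; exact: cv.
  apply: nearW => N; apply: le_trans (horner_lipschitz _ q1 x01 y01) _.
  by rewrite ler_wpM2r // ler_wpM2r ?invr_ge0 ?(ltW q10).
apply/subspace_continuousP => x; rewrite /= in_itv /= => x01.
apply/cvgrPdist_le => e e0; rewrite near_withinE.
have d0 : 0 < e / (M / (q - 1) + 1).
  by rewrite divr_gt0 // ltr_wpDl // divr_ge0 // ltW.
near=> y; rewrite /= in_itv /= => y01.
apply: le_trans (flip _ _ x01 y01) _.
have: `|x - y| <= e / (M / (q - 1) + 1).
  by near: y; apply: cvgr_dist_le.
rewrite ler_pdivlMr; last by rewrite ltr_wpDl // divr_ge0 // ltW.
by apply: le_trans; rewrite mulrC ler_wpM2l // lerDl.
Unshelve. all: by end_near. Qed.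

End Limit.
End PowerSeriesOnUnitInterval.

Section FunctionalLimit.
Variable R : realType.
(* [s] is the end point of the segment; the hypotheses on [a] hold for the
   coefficients [a n = p_n(b)] if these are [O(t^n)] with [t < 1 / r1]. *)
Variables (a : nat -> R) (b r0 r1 M : R) (s : R[i]).
Local Notation V := (fun N => \poly_(n < N) a n).
Hypotheses (r0_gt0 : 0 < r0) (r01 : r0 < r1) (s_le : normc s <= r0).
Hypothesis a0 : a 0 = 0.
Hypothesis aM : forall N, majorant r1 (V N) <= M.
Hypothesis aT :
  forall N, exists G : {poly R}, defect b (V N.+2) = 'X^(N.+1) * G.

Let r1_gt0 : 0 < r1 := lt_trans r0_gt0 r01.

Lemma majorant_affine r N : 0 <= r <= r1 ->
  majorant r (1 + 'X * (V N - b%:P)) <= 1 + r1 * (M + `|b|).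
Proof.
move=> /andP[r_ge0 r_le].
apply: le_trans (majorantD _ _ r_ge0) _.
rewrite -polyC1 majorantC normr1 lerD2l -['X]expr1 majorantXnM expr1.
rewrite ler_pM ?majorant_ge0 // -polyCN.
apply: le_trans (majorantD _ _ r_ge0) _.
rewrite majorantC normrN lerD2r; apply: le_trans (aM N).
by apply: le_majorant; rewrite r_ge0.
Qed.

(** The defect of a truncation is divisible by ['X^(N.+1)] and its majorant on
    an intermediate circle of radius [r] is bounded independently of [N]; on the
    circle of radius [r0] this gains a factor [(r0 / r)^(N.+1)]. *)
Lemma defect_cvg0 : exists2 d : nat -> R,
  forall N, majorant r0 (defect b (V N.+2)) <= d N & d @ \oo --> (0 : R).
Proof.
pose r := (r0 + r1) / 2.
have [r0r rr1] := midf_lt r01; rewrite -/r in r0r rr1.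
have r_gt0 : 0 < r by apply: lt_trans r0r.
pose K := (1 + r1 * (M + `|b|)) / (r1 - r) +
          M / (r1 - r) * (1 + r1 * (M + `|b|)).
exists (fun N => K * (r0 / r) ^+ N.+1); last first.
  rewrite -(mulr0 K); apply: cvgM; first exact: cvg_cst.
  rewrite (cvg_shiftS (fun n => (r0 / r) ^+ n)).
  have := @cvg_geometric R 1 (r0 / r); rewrite exprn_geometric; apply.
  rewrite ger0_norm; last by rewrite divr_ge0 // ltW.
  by rewrite ltr_pdivrMr // mul1r.
move=> N; have [G TG] := aT N.
have KT : majorant r (defect b (V N.+2)) <= K.
  have rr : 0 <= r < r1 by rewrite (ltW r_gt0).
  have r1r : 0 <= (r1 - r)^-1 by rewrite invr_ge0 subr_ge0 ltW.
  apply: le_trans (majorantD _ _ (ltW r_gt0)) _; apply: lerD.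
    apply: le_trans (majorant_deriv _ rr) _; rewrite ler_wpM2r //.
    by apply: majorant_affine; rewrite (ltW r1_gt0) /=.
  apply: le_trans (majorantM _ _ (ltW r_gt0)) _.
  rewrite ler_pM ?majorant_ge0 ?(ltW r_gt0) //.
    by apply: le_trans (majorant_deriv _ rr) _; rewrite ler_wpM2r.
  by apply: majorant_affine; rewrite (ltW r_gt0) ltW.
rewrite TG majorantXnM.
rewrite TG majorantXnM in KT.
have : majorant r0 G <= majorant r G by apply: le_majorant; rewrite !ltW.
move=> /(ler_wpM2l (exprn_ge0 N.+1 (ltW r0_gt0))) /le_trans; apply.
rewrite expr_div_n mulrCA ler_wpM2l ?exprn_ge0 ?(ltW r0_gt0) //.
by rewrite ler_pdivlMr ?exprn_gt0 // mulrC.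
Qed.

Let z N (rho : R) : R[i] := (V N)^:C.[rho%:C%C * s].

(* [f] is [Re] or [Im] in both lemmas below *)
Lemma trunc_part (f : R[i] -> R)
    (fM : forall (c : R) w, f (c%:C%C * w) = c * f w)
    (fD : forall w w', f (w + w') = f w + f w') N rho :
  f (z N rho) = (\poly_(n < N) (a n * f (s ^+ n))).[rho].
Proof.
have f0 : f 0 = 0 by have := fM 0 0; rewrite mulr0 mul0r.
rewrite /z (@horner_coef_wide _ N); last first.
  by rewrite (leq_trans (size_poly _ _)) // size_poly.
rewrite horner_poly (big_morph f fD f0); apply: eq_bigr => i _.
rewrite coef_map coef_poly ltn_ord exprMn -rmorphXn /= !fM; ring.
Qed.

Lemma majorant_part (f : R[i] -> R) (f_le : forall w, `|f w| <= normc w) N :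
  majorant (r1 / r0) (\poly_(n < N) (a n * f (s ^+ n))) <= M.
Proof.
have s_ge0 : 0 <= normc s by have := f_le s; apply: le_trans.
apply: le_trans (aM N); rewrite /majorant.
rewrite !(@horner_coef_wide _ N) ?(leq_trans (size_poly _ _)) ?size_poly //.
apply: ler_sum => i _; rewrite !coef_majorant_poly !coef_poly ltn_ord.
rewrite normrM -mulrA ler_wpM2l // expr_div_n mulrA.
rewrite ler_pdivrMr ?exprn_gt0 // mulrC ler_wpM2l ?exprn_ge0 ?(ltW r1_gt0) //.
apply: le_trans (f_le _) _; rewrite normcX lerXn2r ?nnegrE //.
exact: ltW.
Qed.

(** The truncations [V N] satisfy the differential equation of [exp (- V)] up
    to a defect that tends to 0, hence in the limit [U exp V] is constant along
    the segment from 0 to [s]. The last clause is the differential equation at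
    the end point of the segment, in the case where its leading coefficient
    vanishes there. *)
Lemma functional_limit : exists X Y : R -> R,
  [/\ {within `[0, 1], continuous Y}, Y 0 = 0,
   forall rho : R, 0 <= rho <= 1 ->
     (1 + rho%:C%C * s * (Complex (X rho) (Y rho) - b%:C%C))
     * expC (Complex (X rho) (Y rho)) = 1,
   complex.Im s = 0 -> forall rho, Y rho = 0 &
   s + 1 + s * (Complex (X 1) (Y 1) - b%:C%C) = 0 ->
     Complex (X 1) (Y 1) = b%:C%C].
Proof.
have q1 : 1 < r1 / r0 by rewrite ltr_pdivlMr // mul1r.
have ReE N rho : complex.Re (z N rho) =
    (\poly_(n < N) (a n * complex.Re (s ^+ n))).[rho].
  apply: trunc_part; last exact: ReD.
  by move=> c [x y] /=; rewrite mul0r subr0.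
have ImE N rho : complex.Im (z N rho) =
    (\poly_(n < N) (a n * complex.Im (s ^+ n))).[rho].
  apply: trunc_part; last exact: ImD.
  by move=> c [x y] /=; rewrite mul0r addr0.
have ReM' := majorant_part (@normc_ge_Re R).
have ImM' := majorant_part (@normc_ge_Im R).
pose X rho := limn (fun N => (\poly_(n < N) (a n * complex.Re (s ^+ n))).[rho]).
pose Y rho := limn (fun N => (\poly_(n < N) (a n * complex.Im (s ^+ n))).[rho]).
have shift2 (u : nat -> R) (l : R) : u @ \oo --> l ->
    (fun N => u N.+2) @ \oo --> l.
  by rewrite -cvg_shiftS -cvg_shiftS.
have cX rho : 0 <= rho <= 1 ->
    (fun N => complex.Re (z N.+2 rho)) @ \oo --> X rho.
  move=> rho01; apply: (shift2 (fun N => complex.Re (z N rho))).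
  by under eq_fun do rewrite ReE; exact: (cvgn_poly_trunc q1 ReM' rho01).
have cY rho : 0 <= rho <= 1 ->
    (fun N => complex.Im (z N.+2 rho)) @ \oo --> Y rho.
  move=> rho01; apply: (shift2 (fun N => complex.Im (z N rho))).
  by under eq_fun do rewrite ImE; exact: (cvgn_poly_trunc q1 ImM' rho01).
have [d dT d0] := defect_cvg0.
exists X, Y; split.
- exact: (continuous_lim_poly_trunc q1 ImM').
- rewrite /Y (_ : (fun N => _) = cst 0) ?lim_cst //.
  apply/funext => N; rewrite horner_coef0 coef_poly; case: ifP => // _.
  by rewrite a0 mul0r.
- move=> rho rho01.
  pose P N := (V N.+2)^:C \Po (s *: 'X).
  pose A N : {poly R[i]} := 1 + (s *: 'X) * (P N - (b%:C%C)%:P).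
  have Pz N (t : R) : (P N).[t%:C%C] = z N.+2 t.
    by rewrite horner_comp !hornerE mulrC.
  have Az N (t : R) : (A N).[t%:C%C] = 1 + t%:C%C * s * (z N.+2 t - b%:C%C).
    by rewrite /A !hornerE Pz [s * _]mulrC.
  have PM N (t : R) : 0 <= t <= 1 -> normc (P N).[t%:C%C] <= M.
    move=> /andP[t0 t1]; rewrite Pz.
    have nts : normc (t%:C%C * s) <= r0.
      rewrite normcM (_ : normc t%:C%C = t); last first.
        by rewrite /normc /= expr0n addr0 sqrtr_sqr ger0_norm.
      rewrite (le_trans _ s_le) // ler_piMl //.
      by apply: le_trans (normc_ge_Re s).
    apply: le_trans (normc_horner _ nts) _; apply: le_trans (aM N.+2).
    by apply: le_majorant; rewrite !ltW.
  have Ad N (t : R) : 0 <= t <= 1 ->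
      normc ((A N)^`() + (P N)^`() * A N).[t%:C%C] <= r0 * d N.
    move=> /andP[t0 t1].
    have nts : normc (t%:C%C * s) <= r0.
      rewrite normcM (_ : normc t%:C%C = t); last first.
        by rewrite /normc /= expr0n addr0 sqrtr_sqr ger0_norm.
      rewrite (le_trans _ s_le) // ler_piMl //.
      by apply: le_trans (normc_ge_Re s).
    have AE : A N = (1 + 'X * (V N.+2 - b%:P))^:C \Po (s *: 'X).
      rewrite rmorphD rmorph1 rmorphM rmorphB /= map_polyX map_polyC /=.
      by rewrite comp_polyD comp_polyM comp_polyB comp_polyX !comp_polyC.
    rewrite AE /P !deriv_comp !derivZ !derivX !alg_polyC.
    set q := (1 + 'X * _)^:C.
    rewrite [X in normc X](_ : _ = s * (defect b (V N.+2))^:C.[t%:C%C * s]).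
      rewrite normcM ler_pM //.
      - by apply: le_trans (normc_ge_Re s).
      - by apply: le_trans (normc_ge_Re _).
      - exact: le_trans (normc_horner _ nts) (dT N).
    rewrite /defect rmorphD rmorphM /= -!deriv_map -/q.
    rewrite !(hornerD, hornerM, horner_comp, hornerZ, hornerX, hornerC).
    by rewrite [s * t%:C%C]mulrC; ring.
  have dE : (fun N => expR M * (r0 * d N + r0 * d N)) @ \oo --> (0 : R).
    rewrite [X in _ --> X](_ : 0 = expR M * (r0 * 0 + r0 * 0)); last first.
      by rewrite !mulr0 addr0 mulr0.
    apply: cvgM; first exact: cvg_cst.
    by apply: cvgD; apply: cvgM => //; exact: cvg_cst.
  have z0 N : z N 0 = 0.
    rewrite /z mul0r horner_coef0 coef_map coef_poly; case: ifP => _ //=.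
    by rewrite a0.
  have E0 N : (A N).[(0 : R)%:C%C] * expC (P N).[(0 : R)%:C%C] = 1.
    rewrite Az Pz z0 !mul0r addr0 mul1r /expC /= expR0 cos0 sin0 !mul1r.
    by [].
  have drift N := expC_drift (PM N) (Ad N) rho01.
  have cExp := cvg_comp _ _ (cX _ rho01) (@continuous_expR R (X rho)).
  have cCos := cvg_comp _ _ (cY _ rho01) (@continuous_cos R (Y rho)).
  have cSin := cvg_comp _ _ (cY _ rho01) (@continuous_sin R (Y rho)).
  pose u x y := 1 + rho * (complex.Re s * (x - b) - complex.Im s * y).
  pose v x y := rho * (complex.Re s * y + complex.Im s * (x - b)).
  have ReF w : complex.Re ((1 + rho%:C%C * s * (w - b%:C%C)) * expC w) =
      u (complex.Re w) (complex.Im w) *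
        (expR (complex.Re w) * cos (complex.Im w)) -
      v (complex.Re w) (complex.Im w) *
        (expR (complex.Re w) * sin (complex.Im w)).
    by rewrite /u /v; case: (s) w => ? ? [? ?] /=; ring.
  have ImF w : complex.Im ((1 + rho%:C%C * s * (w - b%:C%C)) * expC w) =
      u (complex.Re w) (complex.Im w) *
        (expR (complex.Re w) * sin (complex.Im w)) +
      v (complex.Re w) (complex.Im w) *
        (expR (complex.Re w) * cos (complex.Im w)).
    by rewrite /u /v; case: (s) w => ? ? [? ?] /=; ring.
  have cc (c : R) : (fun N : nat => c) @ \oo --> c by exact: cvg_cst.
  have cx := cX _ rho01; have cy := cY _ rho01.
  have cu : (fun N => u (complex.Re (z N.+2 rho)) (complex.Im (z N.+2 rho)))
      @ \oo --> u (X rho) (Y rho).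
    apply: cvgD => //; apply: cvgM => //.
    by apply: cvgB; apply: cvgM => //; apply: cvgB.
  have cv : (fun N => v (complex.Re (z N.+2 rho)) (complex.Im (z N.+2 rho)))
      @ \oo --> v (X rho) (Y rho).
    apply: cvgM => //.
    by apply: cvgD; apply: cvgM => //; apply: cvgB.
  set E := LHS.
  have cRe : (fun N => complex.Re ((A N).[rho%:C%C] * expC (P N).[rho%:C%C]))
      @ \oo --> complex.Re E.
    under eq_fun do rewrite Az Pz ReF; rewrite /E ReF.
    by apply: cvgB; apply: cvgM => //; apply: cvgM.
  have cIm : (fun N => complex.Im ((A N).[rho%:C%C] * expC (P N).[rho%:C%C]))
      @ \oo --> complex.Im E.
    under eq_fun do rewrite Az Pz ImF; rewrite /E ImF.
    by apply: cvgD; apply: cvgM => //; apply: cvgM.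
  apply/eqP; rewrite eq_complex; apply/andP; split; apply/eqP.
    apply: (cvg_unique (@Rhausdorff R) cRe) => /=.
    apply: (cvgn_dist_le _ dE) => N.
    by have [+ _] := drift N; rewrite /= E0.
  apply: (cvg_unique (@Rhausdorff R) cIm) => /=.
  apply: (cvgn_dist_le _ dE) => N.
  by have [_ +] := drift N; rewrite /= E0.
- move=> s0 rho; rewrite /Y (_ : (fun N => _) = cst 0) ?lim_cst //.
  have sn n : complex.Im (s ^+ n) = 0.
    by elim: n => [|n IHn] //; rewrite exprS ImM s0 IHn mulr0 mul0r addr0.
  apply/funext => N; rewrite horner_poly big1 // => i _.
  by rewrite sn mulr0 mul0r.
- have one01 : 0 <= (1 : R) <= 1 by rewrite ler01 lexx.
  have cx := cX _ one01; have cy := cY _ one01.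
  set v := Complex (X 1) (Y 1) => sv.
  pose C := M / (r1 - r0) * r0.
  pose e N := d N + C *
    (`|complex.Re (z N.+2 1) - X 1| + `|complex.Im (z N.+2 1) - Y 1|).
  have e0 : e @ \oo --> (0 : R).
    have -> : (0 : R) = 0 + C * (`|X 1 - X 1| + `|Y 1 - Y 1|).
      by rewrite !subrr normr0 addr0 mulr0 addr0.
    apply: cvgD => //; apply: cvgM; first exact: cvg_cst.
    by apply: cvgD; apply: cvg_norm; apply: cvgB => //; exact: cvg_cst.
  have ze N : normc (z N.+2 1 - b%:C%C) <= e N.
    set w := z N.+2 1; pose D := (V N.+2)^`()^:C.[s].
    have wE : w = (V N.+2)^:C.[s] by rewrite /w /z rmorph1 mul1r.
    have Te : (defect b (V N.+2))^:C.[s] =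
        (w - b%:C%C) + s * D + D * (1 + s * (w - b%:C%C)).
      rewrite /defect derivD derivM derivX derivB -polyC1 !derivC subr0 add0r.
      rewrite mul1r !(rmorphD, rmorphM, rmorphN) /= map_polyX !map_polyC /=.
      by rewrite !(hornerD, hornerM, hornerN, hornerX, hornerC) -/D -wE.
    have Tw : (defect b (V N.+2))^:C.[s] = w - b%:C%C + D * (s * (w - v)).
      rewrite Te; transitivity (w - b%:C%C + D * (s + 1 + s * (w - b%:C%C))).
        by ring.
      by rewrite -[X in _ + D * X]subr0 -sv; ring.
    have -> : w - b%:C%C = (defect b (V N.+2))^:C.[s] - D * (s * (w - v)).
      by rewrite Tw addrK.
    apply: le_trans (le_normcD _ _) _; apply: lerD.
      exact: le_trans (normc_horner _ s_le) (dT N).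
    have r10 : 0 <= (r1 - r0)^-1 by rewrite invr_ge0 subr_ge0 ltW.
    rewrite normcN !normcM /C -mulrA.
    have nc (x : R[i]) : 0 <= normc x by apply: le_trans (normc_ge_Re x).
    rewrite ler_pM ?mulr_ge0 ?nc //.
      apply: le_trans (normc_horner _ s_le) _.
      apply: le_trans (majorant_deriv (r' := r1) _ _) _; first by rewrite ltW.
      by rewrite ler_wpM2r.
    rewrite ler_pM ?nc //; apply: le_trans (normc_le_ReIm _) _.
    by rewrite /v /w; case: (z N.+2 1).
  apply/eqP; rewrite eq_complex; apply/andP; split; apply/eqP.
    apply: (cvg_unique (@Rhausdorff R) cx) => /=.
    apply: (cvgn_dist_le _ e0) => N.
    apply: le_trans (ze N); have := normc_ge_Re (z N.+2 1 - b%:C%C).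
    by case: (z N.+2 1).
  apply: (cvg_unique (@Rhausdorff R) cy) => /=.
  apply: (cvgn_dist_le _ e0) => N.
  apply: le_trans (ze N); have := normc_ge_Im (z N.+2 1 - b%:C%C).
  by case: (z N.+2 1) => ? ?; rewrite /= oppr0.
Qed.

End FunctionalLimit.

(** * The growth rate is at least [|w|] *)

Section RadiusUpperBound.
Variable R : realType.

Lemma sin_le_id (x : R) : 0 <= x -> sin x <= x.
Proof.
move=> x0.
have hd (t : R) : t \in `]0, x[%R -> is_derive t (1 : R) (@sin R) (cos t).
  by move=> _; exact: is_derive_sin.
have hc : {within `[0, x], continuous (@sin R)}.
  by apply: derivable_within_continuous => t _; exact: derivable_sin.
have [t _] := MVT_segment x0 hd hc; rewrite sin0 !subr0 => ->.
by rewrite ler_piMl // cos_le1.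
Qed.

Lemma mul_cos_lt_sin (x : R) : 0 < x < pi -> x * cos x < sin x.
Proof.
move=> /andP[x0 xpi]; pose f (t : R) := sin t - t * cos t.
have hd (t : R) : t \in `]0, x[%R -> is_derive t (1 : R) f (t * sin t).
  by move=> _; rewrite /f; apply: is_derive_eq; rewrite /GRing.scale /=; ring.
have hc : {within `[0, x], continuous f}.
  by apply: derivable_within_continuous => t _; rewrite /f.
have [t] := MVT x0 hd hc; rewrite in_itv /= => /andP[t0 tx].
rewrite /f sin0 mul0r !subr0 => fE; rewrite -subr_gt0 fE !mulr_gt0 //.
by rewrite sin_gt0_pi // t0 (lt_trans tx).
Qed.

Lemma ln_lt_subr1 (y : R) : 0 < y -> y != 1 -> 1 + ln y < y.
Proof.
move=> y0 y1; rewrite -[ltRHS]lnK ?posrE //; apply: expR_gt1Dx.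
by rewrite ln_eq0.
Qed.

Lemma sum_geometric_le (x : R) N : 0 <= x < 1 ->
  \sum_(i < N) x ^+ i <= (1 - x)^-1.
Proof.
move=> /andP[x0 x1]; rewrite -[leRHS]mul1r ler_pdivlMr ?subr_gt0 //.
by rewrite mulrC -[1 - x]opprB mulNr -subrX1 opprB lerBlDr lerDl exprn_ge0.
Qed.

Lemma majorant_geometric (a : nat -> R) (C t r : R) N :
  0 <= r -> 0 <= t * r < 1 -> (forall n, `|a n| <= C * t ^+ n) ->
  majorant r (\poly_(n < N) a n) <= C / (1 - t * r).
Proof.
move=> r0 tr aC.
have C0 : 0 <= C by have := aC 0%N; rewrite expr0 mulr1; apply: le_trans.
rewrite /majorant (@horner_coef_wide _ N); last first.
  by rewrite (leq_trans (size_poly _ _)) // size_poly.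
apply: le_trans (ler_wpM2l C0 (sum_geometric_le N tr)).
rewrite mulr_sumr; apply: ler_sum => i _.
rewrite coef_majorant_poly coef_poly ltn_ord exprMn mulrA.
by rewrite ler_wpM2r ?exprn_ge0.
Qed.

Lemma expC_mulN (v : R[i]) : expC v * expC (- v) = 1.
Proof.
case: v => x y; rewrite /expC /= expRN cosN sinN.
apply/eqP; rewrite eq_complex /=; apply/andP; split; apply/eqP; last by ring.
rewrite -[RHS](cos2Dsin2 y); field; exact: lt0r_neq0 (expR_gt0 x).
Qed.

(** The functional equation [1 + rho s (v - b) = e^(- v)] multiplied by
    [w = 1 / s = - K (cos h + i sin h)], in real and imaginary parts. *)
Lemma functional_equation_parts (X Y b K h rho : R) :
  0 < K -> h = K * sin h ->
  (1 + rho%:C%C * Complex (- (cos h / K)) (sin h / K) * (Complex X Y - b%:C%C))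
    * expC (Complex X Y) = 1 ->
  - (K * cos h) + rho * (X - b) = - (K * expR (- X) * cos (h - Y)) /\
  - h + rho * Y = - (K * expR (- X) * sin (h - Y)).
Proof.
move=> K0 hK vE; have K0' : K != 0 by rewrite gt_eqF.
pose w := Complex (- (K * cos h)) (- (K * sin h)).
have sw : Complex (- (cos h / K)) (sin h / K) * w = 1.
  apply/eqP; rewrite eq_complex /=; apply/andP; split; apply/eqP.
    by rewrite -[RHS](cos2Dsin2 h); field.
  by field.
set S := Complex (- (cos h / K)) (sin h / K) in vE sw.
set v := Complex X Y in vE.
have E : w + rho%:C%C * (v - b%:C%C) = w * expC (- v).
  transitivity (w * expC (- v) * ((1 + rho%:C%C * S * (v - b%:C%C)) * expC v)).
    transitivity ((w + rho%:C%C * (S * w) * (v - b%:C%C)) *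
                  (expC v * expC (- v))).
      by rewrite expC_mulN sw !mulr1.
    by ring.
  by rewrite vE mulr1.
move/(congr1 (@complex.Re R)): (E); move/(congr1 (@complex.Im R)): E.
rewrite /w /v /expC /= !cosN !sinN -hK cosB sinB => EI ER.
move: (sin h) (cos h) hK EI ER => sh ch hK EI ER; split.
  transitivity (- (K * ch) + (rho * (X - b) - 0 * (Y - 0))); first by ring.
  by rewrite ER hK; ring.
transitivity (- h + (rho * (Y - 0) + 0 * (X - b))); first by ring.
by rewrite EI hK; ring.
Qed.

(** Let [v = X + i Y] on the segment from 0 to [1 / w] and [B = h - Y]. The
    imaginary part of the functional equation at [rho / w] is
    [h (1 - rho) + rho B = K e^(- X) sin B]. It excludes [B = pi], and [B = 0]
    for [rho < 1]; since [B] starts at [h], it ends in [[0, pi)]. At the end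
    point the equation says that [y = K e^(- X)] satisfies [B = y sin B] and
    [y cos B = 1 + ln y], which is possible only for [B = 0] and [y = 1]. This
    is the critical value of [v]. *)
Lemma lambert_growth_sharp (b K h C t : R) : b != 0 -> 0 < K -> 0 <= h < pi ->
  h = K * sin h -> ln K - K * cos h = b - 1 -> 0 <= t < 1 ->
  (forall n, `|(lambert_poly R n).[b]| <= C * (t * K) ^+ n) -> False.
Proof.
move=> b0 K0 /andP[h0 hpi] hK lnK_eq /andP[t0 t1] aC.
have K0' : K != 0 by rewrite gt_eqF.
pose s : R[i] := Complex (- (cos h / K)) (sin h / K).
have s_le : normc s <= K^-1.
  rewrite /s /normc (_ : _ + _ = K^-1 ^+ 2); last first.
    rewrite -[RHS]mulr1 -(cos2Dsin2 h); field.
    by [].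
  by rewrite sqrtr_sqr ger0_norm // invr_ge0 ltW.
(* any [mu] with [1 < mu < 1 / t] will do: [p_n(b)] is small on a circle of
   radius [mu / K], larger than the length [1 / K] of the segment *)
pose mu := 2 / (1 + t).
have t10 : 0 < 1 + t by lra.
have mu1 : 1 < mu by rewrite /mu ltr_pdivlMr //; lra.
have tmu : t * mu < 1 by rewrite /mu mulrA ltr_pdivrMr //; lra.
have mu0 : 0 < mu by lra.
pose a n := (lambert_poly R n).[b].
have a0 : a 0%N = 0 by rewrite /a lambert_poly0 horner0.
have r01 : K^-1 < mu / K by rewrite ltr_pdivlMr // mulVf.
have aM N : majorant (mu / K) (\poly_(n < N) a n) <= C / (1 - t * K * (mu / K)).
  apply: majorant_geometric => //; first by rewrite divr_ge0 // ltW.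
  have -> : t * K * (mu / K) = t * mu by field.
  by rewrite tmu mulr_ge0 // ltW.
have Ki : 0 < K^-1 by rewrite invr_gt0.
have [X [Y [cY Y0 XY sreal last1]]] :=
  functional_limit Ki r01 s_le a0 aM (dvdXn_defect b).
have eqs rho (rho01 : 0 <= rho <= 1) :=
  functional_equation_parts K0 hK (XY rho rho01).
have Yreal rho : h = 0 -> Y rho = 0.
  by move=> hh; apply: sreal; rewrite /s /= hh sin0 mul0r.
have Y_le : Y 1 <= h.
  rewrite leNgt; apply/negP => hY.
  have [|r] := @IVT R Y 0 1 h ler01 cY.
    have Y1_ge0 : 0 <= Y 1 by rewrite (le_trans h0) // ltW.
    by rewrite Y0 min_l // max_r // h0 ltW.
  rewrite in_itv /= => r01' Yr; have [_] := eqs r r01'.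
  rewrite Yr subrr sin0 mulr0 oppr0 => /eqP; rewrite addrC subr_eq0 => /eqP rh.
  have h_gt0 : 0 < h.
    rewrite lt_def h0 andbT; apply/eqP => hh.
    by move: hY; rewrite Yreal // hh ltxx.
  have r1 : r = 1 by apply: (mulIf (lt0r_neq0 h_gt0)); rewrite rh mul1r.
  by move: hY; rewrite -r1 Yr ltxx.
have Y_gt : h - Y 1 < pi.
  rewrite ltNge; apply/negP => hY.
  have h_gt0 : 0 < h.
    rewrite lt_def h0 andbT; apply/eqP => hh; move: hY.
    by rewrite Yreal // hh subrr leNgt pi_gt0.
  have [|r] := @IVT R Y 0 1 (h - pi) ler01 cY.
    by rewrite Y0 min_r ?max_l; [apply/andP; split| |]; lra.
  rewrite in_itv /= => r01' Yr; have [_] := eqs r r01'.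
  have [r0 r1] := andP r01'.
  rewrite Yr; have -> : h - (h - pi) = pi by ring.
  by rewrite sinpi mulr0 oppr0; nra.
have one01 : 0 <= (1 : R) <= 1 by rewrite ler01 lexx.
have [] := eqs 1 one01; rewrite !mul1r.
set y := K * expR (- X 1); set B := h - Y 1 => ER EI.
have y0 : 0 < y by rewrite mulr_gt0 // expR_gt0.
have lny : ln y = ln K - X 1.
  by rewrite /y lnM ?posrE ?expR_gt0 // expRK.
have ycos : y * cos B = 1 + ln y by rewrite lny; lra.
have ysin : B = y * sin B by rewrite {1}/B; lra.
have B0 : B = 0.
  apply/eqP; apply: contraT => B_n0.
  have B_gt0 : 0 < B by rewrite lt_def B_n0 /B; lra.
  have sinB : 0 < sin B by rewrite sin_gt0_pi // B_gt0.
  have sinB_le := sin_le_id (ltW B_gt0).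
  have y1 : 1 <= y by rewrite -(ler_pM2r sinB) mul1r -ysin.
  have := @mul_cos_lt_sin B; rewrite B_gt0 Y_gt => /(_ isT).
  have -> : B * cos B = (1 + ln y) * sin B by rewrite -ycos {1}ysin; ring.
  have := ln_ge0 y1; nra.
have y1 : y = 1.
  move: ycos; rewrite B0 cos0 mulr1 => yE; apply/eqP; apply: contraT => y_n1.
  by have := ln_lt_subr1 y0 y_n1; rewrite -yE ltxx.
have hY : Y 1 = h by move: B0; rewrite /B; lra.
have vb : Complex (X 1) (Y 1) = b%:C%C.
  have Xb : X 1 - b = K * cos h - 1.
    by move: ER; rewrite B0 cos0 y1 !mulr1 => ER; lra.
  apply: last1; apply/eqP; rewrite eq_complex /s /= Xb hY subr0.
  move: (cos h) (sin h) hK (cos2Dsin2 h) => ch sh hK cs1; rewrite hK.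
  apply/andP; split; apply/eqP; last by field.
  by transitivity (1 - (ch ^+ 2 + sh ^+ 2)); [field|rewrite cs1 subrr].
case: vb => X1 Y1; move: ER; rewrite B0 cos0 X1 subrr addr0 mulr1 y1 => Kc.
have h00 : h = 0 by rewrite -hY.
move: Kc lnK_eq; rewrite h00 cos0 !mulr1 => /oppr_inj ->; rewrite ln1 => b00.
by case/eqP: b0; lra.
Qed.

End RadiusUpperBound.

(** * The branch [W_(-1)] in polar form *)

Section LambertPolar.
Variable R : realType.

(** The number [- expR x] is then a solution [w <= - 1] of
    [w e^w = - e^(b - 1)]. *)
Lemma lambert_real_exists (b : R) : b <= 0 ->
  exists2 x : R, 0 <= x & expR x - x = 1 - b.
Proof.
move=> b0; pose f (x : R) := expR x - x.
have M0 : 0 <= 1 - b by lra.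
have fc : {within `[0, 1 - b], continuous f}.
  by apply: derivable_within_continuous => t _; rewrite /f.
have fM : 1 - b <= f (1 - b).
  rewrite /f; set M := 1 - b in M0 *.
  have -> : expR M = expR (M / 2) * expR (M / 2).
    by rewrite -expRD; congr expR; lra.
  have := expR_ge1Dx (M / 2); move: (expR _) => E ME.
  have : (1 + M / 2) * (1 + M / 2) <= E * E by apply: ler_pM; lra.
  have : 0 <= (1 - M / 2) * (1 - M / 2) by rewrite -expr2 sqr_ge0.
  lra.
have [|x] := @IVT R f 0 (1 - b) (1 - b) M0 fc.
  have f0 : f 0 = 1 by rewrite /f expR0 subr0.
  by rewrite f0 min_l ?max_r; [apply/andP; split| |]; lra.
by rewrite in_itv /= => /andP[x0 _] fx; exists x.
Qed.

(** For [w = - K (cos h + i sin h)] with [K = h / sin h], the number [w e^w] is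
    [- K e^(- K cos h)], and it remains to adjust [h]. The left-hand side
    increases from [- 1] to infinity on the interval from 0 to [pi]; explicit
    points where it is on either side of [b - 1] are [min (b, pi / 2)] and
    [pi - atan (1 / b)]. *)
Lemma lambert_polar_exists (b : R) : 0 < b ->
  exists2 h : R, 0 < h < pi & ln (h / sin h) - h / sin h * cos h = b - 1.
Proof.
move=> b0; pose f (h : R) := ln (h / sin h) - h / sin h * cos h.
have pi2 : 1 <= (pi : R) / 2 := pihalf_ge1 R.
pose d := atan b^-1; pose h1 := Num.min b (pi / 2); pose h2 := pi - d.
have dpi : d < pi / 2 := atan_ltpi2 _.
have d0 : 0 < d by rewrite /d -(@atan0 R) lt_atan // invr_gt0.
have h10 : 0 < h1 by rewrite /h1 lt_min b0 /=; lra.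
have h1b : h1 <= b by rewrite /h1 ge_min lexx.
have h1pi : h1 <= pi / 2 by rewrite /h1 ge_min lexx orbT.
have h12 : h1 <= h2 by rewrite /h2; lra.
have sin_gt0 (x : R) : 0 < x < pi -> 0 < sin x by exact: sin_gt0_pi.
have fc : {within `[h1, h2], continuous f}.
  apply: continuous_in_subspaceT => x; rewrite inE /= in_itv /= => /andP[x1 x2].
  have sx : 0 < sin x.
    by apply: sin_gt0; rewrite /h2 in x2; apply/andP; split; lra.
  have x0 : 0 < x by lra.
  have cq : (fun y : R => y / sin y) @ x --> x / sin x.
    apply: cvgM; first exact: cvg_id.
    by apply: cvgV; [rewrite gt_eqF|exact: continuous_sin].
  apply: cvgB; last by apply: cvgM => //; exact: continuous_cos.
  apply: (cvg_comp _ _ cq); apply: continuous_ln; exact: divr_gt0.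
have f1 : f h1 <= b - 1.
  have sh : 0 < sin h1 by apply: sin_gt0; apply/andP; split; lra.
  have ch : 0 <= cos h1 by apply: cos_ge0_pihalf; apply/andP; split; lra.
  have cs := cos2Dsin2 h1.
  have c1s : 1 - cos h1 <= sin h1 by nra.
  have q0 : 0 < h1 / sin h1 by rewrite divr_gt0.
  have lnq : ln (h1 / sin h1) <= h1 / sin h1 - 1.
    have qE : 1 + (h1 / sin h1 - 1) = h1 / sin h1 by ring.
    by rewrite -{1}qE; apply: le_ln1Dx; lra.
  have : h1 / sin h1 * (1 - cos h1) <= h1.
    rewrite mulrAC ler_pdivrMr // ler_wpM2l //; lra.
  rewrite /f; lra.
have f2 : b - 1 <= f h2.
  have h2pi : 0 < h2 < pi by rewrite /h2; apply/andP; split; lra.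
  have sh : 0 < sin h2 by apply: sin_gt0.
  have h2_gt : 0 <= h2 by have /andP[/ltW] := h2pi.
  have q1 : 1 <= h2 / sin h2 by rewrite ler_pdivlMr // mul1r sin_le_id.
  have lnq := ln_ge0 q1.
  have cd : 0 < cos d by rewrite cos_gt0_pihalf //; apply/andP; split; lra.
  have tand : cos d = b * sin d.
    have := atanK b^-1; rewrite -/d /tan => tE.
    have -> : sin d = b^-1 * cos d by rewrite -tE divfK // gt_eqF.
    by field; rewrite gt_eqF.
  have sE : sin h2 = sin d by rewrite /h2 sinB sinpi cospi; ring.
  have cE : cos h2 = - (b * sin d) by rewrite /h2 cosB sinpi cospi -tand; ring.
  rewrite /f cE sE; rewrite sE in sh lnq.
  have -> : h2 / sin d * - (b * sin d) = - (h2 * b).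
    by field; rewrite gt_eqF.
  have : 1 <= h2 by rewrite /h2; lra.
  nra.
have [|h] := @IVT R f h1 h2 (b - 1) h12 fc.
  have f12 := le_trans f1 f2.
  by rewrite min_l // max_r // f1.
rewrite in_itv /= => /andP[hh1 hh2] fh; exists h => //.
by rewrite /h2 in hh2; apply/andP; split; lra.
Qed.

(** The parameters [K = |w|] and [h = - Im w] of [w = W_(-1)(- e^(b - 1))]:
    [h = K sin h] says that [- K (cos h + i sin h)] has imaginary part [- h],
    which is what makes [w e^w] a negative real. *)
Lemma lambertWm1_polar (b : R) : exists K h : R,
  [/\ 0 < K, 0 <= h < pi, h = K * sin h, ln K - K * cos h = b - 1 &
   complex.Re (lambertWm1 (- expR (b - 1))) = - (K * cos h)] /\
  if b <= 0 then h = 0 /\ 1 <= K else 0 < h.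
Proof.
have branch : (- expR (- 1) <= - expR (b - 1)) = (b <= 0).
  by rewrite lerN2 ler_expR; apply/idP/idP; lra.
have /xgetPex : exists w : R[i], is_lambertWm1 (- expR (b - 1)) w.
  rewrite /is_lambertWm1 branch; case: leP => b0.
    have [x x0 xE] := lambert_real_exists b0; exists (Complex (- expR x) 0).
    split=> /=; last by rewrite lerN2 -expR0 ler_expR.
    rewrite /expC /= cos0 sin0; apply/eqP; rewrite eq_complex /=.
    apply/andP; split; apply/eqP; last by ring.
    have -> : b - 1 = x - expR x by lra.
    by rewrite expRD; ring.
  have [h /andP[h0 hpi] hE] := lambert_polar_exists b0.
  have sh : 0 < sin h by rewrite sin_gt0_pi // h0.
  set K := h / sin h in hE; have K0 : 0 < K by rewrite divr_gt0.
  have hK : h = K * sin h by rewrite /K divfK // gt_eqF.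
  exists (Complex (- (K * cos h)) (- h)); split=> /=; last by split; lra.
  have -> : expR (b - 1) = K * expR (- (K * cos h)).
    by rewrite -hE expRD lnK.
  rewrite /expC /= cosN sinN.
  move: (cos h) (sin h) (cos2Dsin2 h) hK => c s cs1 ->.
  apply/eqP; rewrite eq_complex /=; apply/andP; split; apply/eqP.
    transitivity (- (K * expR (- (K * c))) * (c ^+ 2 + s ^+ 2)); first by ring.
    by rewrite cs1 mulr1.
  by ring.
move=> /(_ 0); rewrite -/(lambertWm1 _).
case: (lambertWm1 _) => x y []; rewrite /expC /= => wE; rewrite branch.
move: wE => [Re_w Im_w]; case: (leP b 0) => b0 [y_cond x_cond].
  move: y_cond x_cond => y0 x1; exists (- x), 0.
  rewrite sin0 cos0 mulr0 !mulr1 opprK.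
  split; last by split; lra.
  split=> //; first lra.
    by rewrite lexx pi_gt0.
  move: Re_w; rewrite y0 cos0 sin0 !mulr1 mul0r subr0 => e.
  have xE : - x * expR x = expR (b - 1) by rewrite mulNr e opprK.
  by rewrite -[b - 1]expRK -xE lnM ?posrE ?expR_gt0 ?expRK //; lra.
move: y_cond x_cond => ypi y0; pose h := - y.
have yE : y = - h by rewrite opprK.
have h0 : 0 < h by rewrite /h; lra.
have hpi : h < pi by rewrite /h; lra.
have sh : 0 < sin h by rewrite sin_gt0_pi // h0.
have K0 : 0 < h / sin h by rewrite divr_gt0.
have ex : 0 < expR x := expR_gt0 x.
have xE : x = - (h / sin h * cos h).
  apply: (mulIf (lt0r_neq0 sh)); apply: (mulIf (lt0r_neq0 ex)).
  move: Im_w; rewrite yE cosN sinN => Im_w.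
  transitivity (- (h * cos h) * expR x); first lra.
  by field; rewrite gt_eqF.
exists (h / sin h), h; split=> //; split=> //.
- by rewrite ltW.
- by rewrite divfK // gt_eqF.
have e1 : h / sin h * expR x = expR (b - 1).
  apply: oppr_inj; rewrite -Re_w yE cosN sinN {2}xE.
  transitivity (- (h / sin h * expR x * (cos h ^+ 2 + sin h ^+ 2))).
    by rewrite cos2Dsin2 mulr1.
  by field; rewrite gt_eqF.
by rewrite -xE -[b - 1]expRK -e1 [in RHS]lnM ?posrE // expRK.
Qed.

End LambertPolar.

(** * Cauchy estimates *)

Section CauchyEstimate.
Variable R : realType.

Definition cis (x : R) : R[i] := Complex (cos x) (sin x).

Lemma cisX x n : cis x ^+ n = cis (n%:R * x).
Proof.
elim: n => [|n IHn]; first by rewrite expr0 mul0r /cis cos0 sin0.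
rewrite exprS IHn /cis -nat1r mulrDl mul1r cosD sinD.
by apply/eqP; rewrite eq_complex /=; apply/andP; split; apply/eqP; ring.
Qed.

Lemma normc_cis x : normc (cis x) = 1.
Proof. by rewrite /cis /normc cos2Dsin2 sqrtr1. Qed.

Lemma cis_neq1 (x : R) : 0 < x < pi *+ 2 -> cis x != 1.
Proof.
move=> /andP[x0 x2pi]; rewrite eq_complex negb_and /=.
have sx : 0 < sin (x / 2) by rewrite sin_gt0_pi //; apply/andP; split; lra.
have -> : x = (x / 2) *+ 2 by rewrite mulr2n; lra.
rewrite cos_mulr2n cos2sin2; apply/orP; left; apply/eqP => E.
have : 0 < sin (x / 2) ^+ 2 by rewrite exprn_gt0.
lra.
Qed.

Lemma sum_cis_eq0 N m : (0 < m < N)%N ->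
  \sum_(k < N) cis (pi *+ 2 / N%:R) ^+ (m * k) = 0.
Proof.
move=> /andP[m0 mN]; have N0 : (0 : R) < N%:R by rewrite ltr0n (leq_trans _ mN).
set w := cis _; have wN : w ^+ N = 1.
  by rewrite /w cisX mulrC divfK ?gt_eqF // /cis cos2pi sin2pi.
have wm : w ^+ m != 1.
  rewrite /w cisX cis_neq1 // mulrCA; have pi0 := @pi_gt0 R.
  have tpi : (0 : R) < pi *+ 2 by rewrite pmulrn_lgt0.
  apply/andP; split; first by rewrite mulr_gt0 // divr_gt0 // ltr0n.
  by rewrite gtr_pMr // ltr_pdivrMr // mul1r ltr_nat.
under eq_bigr do rewrite exprM.
have := subrX1 (w ^+ m) N; rewrite -exprM mulnC exprM wN expr1n subrr.
by move/esym/eqP; rewrite mulf_eq0 subr_eq0 (negPf wm) => /eqP.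
Qed.

(** The mean of [P(z) z^(- n)] over the points [z = r w^k], where [w] is a
    root of unity of order larger than the degree of [P], is the coefficient. *)
Lemma cauchy_estimate (P : {poly R[i]}) (r B : R) n : 0 < r ->
  (forall z, normc z = r -> normc P.[z] <= B) -> normc P`_n * r ^+ n <= B.
Proof.
move=> r0 PB.
have [sP|nP] := leqP (size P) n.
  rewrite nth_default // normc0 mul0r.
  apply: le_trans (PB r%:C%C _).
    exact: le_trans (normr_ge0 _) (normc_ge_Re _).
  by rewrite /normc /= expr0n addr0 sqrtr_sqr ger0_norm // ltW.
have [N sPN nN] : exists2 N, (size P <= N)%N & (n < N)%N by exists (size P).
clear nP; pose w := cis (pi *+ 2 / N%:R).
have N0 : (0 : R) < N%:R by rewrite ltr0n (leq_ltn_trans _ nN).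
have wN : w ^+ N = 1.
  by rewrite /w cisX mulrC divfK ?gt_eqF // /cis cos2pi sin2pi.
pose x k := r%:C%C * w ^+ k.
have nwX k : normc (w ^+ k) = 1 by rewrite /w cisX normc_cis.
have nx k : normc (x k) = r.
  rewrite /x normcM nwX mulr1 /normc /= expr0n addr0 sqrtr_sqr.
  by rewrite ger0_norm // ltW.
have mean : \sum_(k < N) P.[x k] * w ^+ ((N - n) * k) =
    N%:R * (P`_n * r%:C%C ^+ n).
  under eq_bigr do rewrite (@horner_coef_wide _ N) // mulr_suml.
  rewrite exchange_big /= (bigD1 (Ordinal nN)) //= [X in _ + X]big1 ?addr0.
    rewrite mulr_natl -[X in _ *+ X](card_ord N) -sumr_const.
    apply: eq_bigr => k _; rewrite /x exprMn -!exprM mulrA -mulrA -exprD.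
    by rewrite mulnC -mulnDl subnKC 1?ltnW // exprM wN expr1n mulr1.
  move=> i i_n; have {i_n} i_n : (i : nat) != n.
    by apply: contra i_n => /eqP ?; apply/eqP/val_inj.
  have iN := ltn_ord i.
  pose m := if (i < n)%N then (i + (N - n))%N else (i - n)%N.
  have mN : (0 < m < N)%N.
    rewrite /m; move: (nat_of_ord i) iN i_n => k kN kn.
    by case: (ltnP k n) => kn' /=; lia.
  transitivity (P`_i * r%:C%C ^+ i * \sum_(k < N) w ^+ (m * k)); last first.
    by rewrite sum_cis_eq0 // mulr0.
  rewrite mulr_sumr.
  apply: eq_bigr => k _; rewrite /x exprMn -exprM mulrA -mulrA -exprD.
  congr (_ * _).
  rewrite -/w mulnC -mulnDl /m; case: (ltnP i n) => // ni.
  rewrite (_ : (i + (N - n)) * k = (i - n) * k + N * k)%N; last by nia.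
  by rewrite exprD [X in _ * X]exprM wN expr1n mulr1.
have : N%:R%:C%C * `|P`_n * r%:C%C ^+ n| <= N%:R%:C%C * B%:C%C.
  have -> : N%:R%:C%C * `|P`_n * r%:C%C ^+ n| = `|N%:R * (P`_n * r%:C%C ^+ n)|.
    by rewrite [in RHS]normrM normr_nat rmorph_nat.
  rewrite -mean; apply: le_trans (ler_norm_sum _ _ _) _.
  rewrite rmorph_nat mulr_natl -[X in _ <= _ *+ X](card_ord N) -sumr_const.
  apply: ler_sum => k _; rewrite normrM.
  have -> : `|w ^+ ((N - n) * k)| = 1 by rewrite -[LHS]/((normc _)%:C%C) nwX.
  by rewrite mulr1 lecR PB.
rewrite ler_pM2l ?ltcR // normrM normrX.
have -> : `|r%:C%C| = r%:C%C.
  by rewrite normc_def /= expr0n addr0 sqrtr_sqr ger0_norm // ltW.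
by rewrite -[`|P`_n|]/((normc _)%:C%C) -rmorphXn -rmorphM lecR.
Qed.

(** So [p_n(b)] is the coefficient of [z^n] in the entire function
    [e^(b z) prod_(0 < j < n) (j - z)]. *)
Lemma lambert_polyE (b : R) n : (lambert_poly R n.+1).[b] =
  \sum_(m < n.+2) b ^+ m / m`!%:R *
    (\prod_(1 <= j < n.+1) (j%:R%:P - 'X) : {poly R})`_(n.+1 - m).
Proof.
rewrite horner_poly; apply: eq_bigr => m _; rewrite coef_prod_subX.
case: eqP => [->|_]; last by ring.
by rewrite subn0 stirling_cycle_gt !mulr0 mul0r.
Qed.

Lemma cvgn_binomial_coef (b : R) m :
  (fun M => ('C(M.+1, m)%:R * (b / M.+1%:R) ^+ m : R)) @ \oo -->
  b ^+ m / m`!%:R.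
Proof.
have ratio : (fun M => (M.+1 ^_ m)%:R / (M.+1%:R ^+ m) : R) @ \oo --> (1 : R).
  elim: m => [|m IHm].
    by under eq_fun do rewrite ffactn0 expr0 divr1; exact: cvg_cst.
  have step : (fun M => (M.+1 - m)%:R / M.+1%:R : R) @ \oo --> (1 : R).
    have lim1 : (fun M => 1 - m%:R * harmonic M : R) @ \oo --> (1 : R).
      rewrite -[X in _ --> X]subr0 -[X in _ - X](mulr0 (m%:R : R)).
      apply: cvgB; first exact: cvg_cst.
      by apply: cvgM; [exact: cvg_cst|exact: cvg_harmonic].
    apply: cvg_trans lim1; apply: near_eq_cvg; near=> M.
    have mM : (m <= M.+1)%N.
      by rewrite ltnW // ltnS; near: M; exact: nbhs_infty_ge.
    by rewrite natrB // mulrBl divff ?pnatr_eq0.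
  rewrite -[X in _ --> X](mulr1 1).
  under eq_fun do rewrite ffactnSr natrM exprSr invfM mulrACA.
  exact: cvgM.
have -> : (fun M => ('C(M.+1, m)%:R * (b / M.+1%:R) ^+ m : R)) =
    (fun M => (M.+1 ^_ m)%:R / (M.+1%:R ^+ m) * (b ^+ m / m`!%:R)).
  apply/funext => M; rewrite -bin_ffact natrM expr_div_n; field.
  by rewrite pnatr_eq0 -lt0n fact_gt0 expf_neq0 // ?pnatr_eq0 //.
rewrite -[X in _ --> X]mul1r; apply: cvgM => //; exact: cvg_cst.
Unshelve. all: by end_near. Qed.

Lemma cvgn_sum_ord n (f : 'I_n -> nat -> R) (l : 'I_n -> R) :
  (forall i, f i @ \oo --> l i) ->
  (fun M => \sum_(i < n) f i M) @ \oo --> \sum_(i < n) l i.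
Proof.
elim: n f l => [|n IHn] f l fl.
  by rewrite big_ord0; under eq_fun do rewrite big_ord0; exact: cvg_cst.
rewrite big_ord_recl; under eq_fun do rewrite big_ord_recl.
by apply: cvgD => //; apply: IHn.
Qed.

(** A polynomial that tends to [e^(b z) prod_(0 < j <= n) (j - z)] as [M] grows:
    Cauchy estimates are then needed for polynomials only. *)
Definition lambert_approx (b : R) n M : {poly R} :=
  (1 + (b / M.+1%:R) *: 'X) ^+ M.+1 * \prod_(1 <= j < n.+1) (j%:R%:P - 'X).

Lemma cvgn_lambert_approx (b : R) n :
  (fun M => (lambert_approx b n M)`_n.+1) @ \oo --> (lambert_poly R n.+1).[b].
Proof.
rewrite lambert_polyE.
have -> : (fun M => (lambert_approx b n M)`_n.+1) = (fun M => \sum_(m < n.+2)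
    'C(M.+1, m)%:R * (b / M.+1%:R) ^+ m *
    (\prod_(1 <= j < n.+1) (j%:R%:P - 'X) : {poly R})`_(n.+1 - m)).
  apply/funext => M; rewrite coefM; apply: eq_bigr => m _; congr (_ * _).
  rewrite exprDn coef_sum.
  under eq_bigr do rewrite expr1n mul1r exprZn coefMn coefZ coefXn.
  have [mM|Mm] := ltnP m M.+2.
    rewrite (bigD1 (Ordinal mM)) //= eqxx mulr1 big1 ?addr0 ?mulr_natl //.
    move=> i im; rewrite (_ : (m == i :> nat) = false) ?mulr0 ?mul0rn //.
    by apply: contraNF im => /eqP mi; apply/eqP/val_inj.
  rewrite bin_small // mul0r big1 // => i _.
  rewrite (_ : (m == i :> nat) = false) ?mulr0 ?mul0rn //.
  by apply/eqP => mi; have := ltn_ord i; rewrite -mi ltnNge Mm.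
apply: cvgn_sum_ord => m; apply: cvgM; first exact: cvgn_binomial_coef.
exact: cvg_cst.
Qed.

(** The factor [expR (E / M.+1%:R)] leaves room for the difference between
    [e^(b z)] and [(1 + b z / M.+1)^M.+1] on the circle. *)
Lemma lambert_cauchy (b r B E : R) n : 0 < r ->
  (forall M z, normc z = r ->
    normc (lambert_approx b n M)^:C.[z] <= B * expR (E / M.+1%:R)) ->
  `|(lambert_poly R n.+1).[b]| * r ^+ n.+1 <= B.
Proof.
move=> r0 H.
have cL : (fun M => `|(lambert_approx b n M)`_n.+1| * r ^+ n.+1) @ \oo -->
    `|(lambert_poly R n.+1).[b]| * r ^+ n.+1.
  apply: cvgM; last exact: cvg_cst.
  by apply: cvg_norm; exact: cvgn_lambert_approx.
have cR : (fun M => B * expR (E / M.+1%:R)) @ \oo --> B.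
  rewrite -[X in _ --> X]mulr1; apply: cvgM; first exact: cvg_cst.
  rewrite [X in _ --> X](_ : 1 = expR (E * 0)); last by rewrite mulr0 expR0.
  apply: continuous_cvg; first exact: continuous_expR.
  apply: cvgM; [exact: cvg_cst|exact: cvg_harmonic].
have cLi := cvgP _ cL; have cRi := cvgP _ cR.
rewrite -(cvg_lim (@Rhausdorff R) cL) -(cvg_lim (@Rhausdorff R) cR).
apply: ler_lim => //; apply: nearW => M.
have := cauchy_estimate n.+1 r0 (H M).
by rewrite coef_map /normc /= expr0n addr0 sqrtr_sqr.
Qed.

End CauchyEstimate.

(** * The growth rate is at most [|w|]: nonpositive parameters *)

Section GrowthNonpositive.
Variable R : realType.

(** The error of the Riemann sums of [n f] stays bounded as [n] grows, so that
    passing to the integral costs only a constant factor in exponentials. *)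
Lemma riemann_sum (F f df : R -> R) (L : R) n :
  (forall x : R, 0 <= x <= 1 -> is_derive x (1 : R) F (f x)) ->
  (forall x : R, 0 <= x <= 1 -> is_derive x (1 : R) f (df x)) ->
  (forall x : R, 0 <= x <= 1 -> `|df x| <= L) ->
  `|\sum_(j < n.+1) f (j.+1%:R / n.+1%:R) - n.+1%:R * (F 1 - F 0)| <= L.
Proof.
move=> dF dfE dfL; have n0 : (0 : R) < n.+1%:R by rewrite ltr0n.
pose x (j : nat) : R := j%:R / n.+1%:R.
have x0 j : 0 <= x j by rewrite divr_ge0.
have x1 j : (j <= n.+1)%N -> x j <= 1.
  by move=> jn; rewrite ler_pdivrMr // mul1r ler_nat.
have xS j : x j.+1 - x j = n.+1%:R^-1.
  by rewrite /x -mulrBl -natrB // subSnn mul1r.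
have mvt (g dg : R -> R) (u v : R) : 0 <= u -> u <= v -> v <= 1 ->
    (forall y : R, 0 <= y <= 1 -> is_derive y (1 : R) g (dg y)) ->
    exists2 c, u <= c <= v & g v - g u = dg c * (v - u).
  move=> u0 uv v1 gd.
  have gd' (t : R) : t \in `]u, v[%R -> is_derive t (1 : R) g (dg t).
    by rewrite in_itv /= => /andP[ut tv]; apply: gd; apply/andP; split; lra.
  have gc : {within `[u, v], continuous g}.
    apply: derivable_within_continuous => t; rewrite in_itv /= => /andP[ut tv].
    have [] // : is_derive t (1 : R) g (dg t).
    by apply: gd; apply/andP; split; lra.
  have [c] := MVT_segment uv gd' gc; rewrite in_itv /= => cuv ->.
  by exists c.
have -> : F 1 - F 0 = \sum_(j < n.+1) (F (x j.+1) - F (x j)).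
  rewrite -(big_mkord xpredT (fun j => F (x j.+1) - F (x j))) telescope_sumr //.
  by rewrite /x divff ?gt_eqF // mul0r.
rewrite mulr_sumr -sumrB; apply: le_trans (ler_norm_sum _ _ _) _.
have -> : L = \sum_(j < n.+1) L / n.+1%:R.
  by rewrite sumr_const card_ord -[RHS]mulr_natr divfK // gt_eqF.
apply: ler_sum => j _; have jn := ltn_ord j.
have xjS : x j <= x j.+1 by rewrite -subr_ge0 xS invr_ge0 ltW.
have [c /andP[jc cj] ->] := mvt F f _ _ (x0 j) xjS (x1 _ jn) dF.
rewrite xS mulrCA mulfV ?gt_eqF // mulr1 -/(x j.+1).
have c0 : 0 <= c by apply: le_trans jc.
have [d /andP[cd dj] ->] := mvt f df _ _ c0 cj (x1 _ jn) dfE.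
have d01 : 0 <= d <= 1 by rewrite (le_trans c0 cd) (le_trans dj) // x1.
rewrite normrM ler_pM ?dfL // ger0_norm ?subr_ge0 //.
by rewrite -(xS j) lerB.
Qed.

Lemma horner_lambert_approx (b : R) n M (z : R[i]) :
  (lambert_approx b n M)^:C.[z] =
  (1 + (b / M.+1%:R)%:C%C * z) ^+ M.+1 * \prod_(j < n) (j.+1%:R%:C%C - z).
Proof.
rewrite /lambert_approx rmorphM rmorphXn rmorphD rmorph1 rmorph_prod /=.
rewrite map_polyZ map_polyX hornerM horner_exp hornerD hornerZ hornerX /=.
rewrite -polyC1 hornerC; congr (_ * _).
rewrite big_add1 /= horner_prod big_mkord; apply: eq_bigr => j _.
by rewrite rmorphB /= map_polyX map_polyC /= hornerD hornerN hornerX hornerC.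
Qed.

Lemma normc_prod n (f : 'I_n -> R[i]) :
  normc (\prod_(i < n) f i) = \prod_(i < n) normc (f i).
Proof. exact: (big_morph _ (@normcM R) (normc1 R)). Qed.

Lemma normc_real (x : R) : normc x%:C%C = `|x|.
Proof. by rewrite /normc /= expr0n addr0 sqrtr_sqr. Qed.

(** On the circle of radius [n r] the modulus of
    [e^(b z) prod_(0 < j < n) (j - z)] is at most
    [e^(|b| n r) prod_(0 < j < n) (j + n r)], which is about
    [(n e^(|b| r + int_0^1 ln (x + r) dx))^n]; for [|b| = y - 1 - ln y] the best
    radius is given by [r = 1 / (y - 1)], and the bound is then [(n r y)^n]. For
    [b <= 0] the bound is the growth rate of [p_n(b)], with [- y] in the place
    of [w]: all the terms of [p_n(b)] have the same sign. *)
Lemma lambert_growth_nonpos (y : R) : 1 < y -> exists C : R,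
  forall b n, `|b| <= y - 1 - ln y ->
    `|(lambert_poly R n.+1).[b]| <= C * y ^+ n.+1.
Proof.
move=> y1; set B := y - 1 - ln y.
have y0 : 0 < y by lra.
pose r := (y - 1)^-1; have r0 : 0 < r by rewrite invr_gt0 subr_gt0.
pose f (x : R) := ln (x + r); pose F (x : R) := (x + r) * ln (x + r) - x.
have fd (x : R) : 0 <= x <= 1 -> is_derive x (1 : R) f (x + r)^-1.
  move=> /andP[x0 x1]; have xr : 0 < x + r by lra.
  have := @is_derive1_comp R (@ln R) (fun x => x + r) x _ _ (is_derive1_ln xr).
  move=> /(_ 1); rewrite mulr1; apply.
  by apply: is_derive_eq; rewrite addr0.
have Fd (x : R) : 0 <= x <= 1 -> is_derive x (1 : R) F (f x).
  move=> x01; have xr : x + r != 0 by rewrite gt_eqF; lra.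
  have fdx := fd x x01.
  have -> : F = (fun x => (x + r) * f x - x) by [].
  apply: is_derive_eq; rewrite /GRing.scale /= /f; field.
  by [].
have fL (x : R) : 0 <= x <= 1 -> `|(x + r)^-1| <= r^-1.
  move=> /andP[x0 x1]; rewrite ger0_norm ?invr_ge0; last lra.
  by rewrite lef_pV2 ?posrE; lra.
exists (expR r^-1) => b n bB.
have n0 : (0 : R) < n.+1%:R by rewrite ltr0n.
have nr0 : 0 < n.+1%:R * r by rewrite mulr_gt0.
rewrite -(ler_pM2r (exprn_gt0 n.+1 nr0)).
have bound : \prod_(j < n) (j.+1%:R + n.+1%:R * r) * expR (B * (n.+1%:R * r))
    <= expR r^-1 * y ^+ n.+1 * (n.+1%:R * r) ^+ n.+1.
  have prodE : \prod_(j < n) (j.+1%:R + n.+1%:R * r) =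
      n.+1%:R ^+ n * expR (\sum_(j < n) f (j.+1%:R / n.+1%:R)).
    rewrite expR_sum -[X in n.+1%:R ^+ X](card_ord n) -prodr_const.
    rewrite -big_split /=.
    apply: eq_bigr => j _; rewrite /f lnK ?posrE.
      by rewrite mulrDr mulrCA mulfV ?mulr1 ?gt_eqF.
    by rewrite ltr_wpDl // divr_ge0.
  have sumB :
      \sum_(j < n) f (j.+1%:R / n.+1%:R) <= n.+1%:R * (F 1 - F 0) + r^-1.
    have := riemann_sum n Fd fd fL; rewrite big_ord_recr /= divff ?gt_eqF //.
    have : 0 <= f 1 by rewrite /f ln_ge0; lra.
    by move=> f1 /ler_normlP[_]; lra.
  have FE : F 1 - F 0 + B * r = ln y + ln r.
    have r1E : 1 + r = y * r by rewrite /r; field; rewrite gt_eqF // subr_gt0.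
    rewrite /F /B r1E lnM ?posrE // !add0r.
    have rE : r * (y - 1) = 1 by rewrite /r mulVf // gt_eqF // subr_gt0.
    have -> : y * r = 1 + r by rewrite -r1E.
    lra.
  rewrite prodE -[X in X <= _]mulrA -expRD.
  have yN : y ^+ n.+1 = expR (n.+1%:R * ln y) by rewrite expRM_natl lnK.
  have rN : r ^+ n.+1 = expR (n.+1%:R * ln r) by rewrite expRM_natl lnK.
  rewrite exprMn yN rN [leRHS]mulrCA -!expRD ler_pM ?exprn_ge0 ?expR_ge0 //.
    by apply: ler_weXn2l; rewrite ?ler1n.
  rewrite ler_expR; move: (\sum_(j < n) _) sumB => S; nra.
apply: le_trans bound; apply: (@lambert_cauchy _ _ _ _ 0); first exact: nr0.
move=> M z zr; rewrite mul0r expR0 mulr1 horner_lambert_approx.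
rewrite normcM normcX normc_prod.
rewrite mulrC ler_pM ?prodr_ge0 ?exprn_ge0 //.
- by move=> j _; exact: le_trans (normr_ge0 _) (normc_ge_Re _).
- exact: le_trans (normr_ge0 _) (normc_ge_Re _).
- apply: ler_prod => j _; rewrite (le_trans (normr_ge0 _) (normc_ge_Re _)) /=.
  by rewrite (le_trans (le_normcD _ _)) // normcN normc_real zr ger0_norm.
have M0 : (0 : R) < M.+1%:R by rewrite ltr0n.
have -> : B * (n.+1%:R * r) = M.+1%:R * (B * (n.+1%:R * r) / M.+1%:R).
  by rewrite [RHS]mulrC divfK // gt_eqF.
rewrite expRM_natl lerXn2r ?nnegrE ?expR_ge0 //.
  exact: le_trans (normr_ge0 _) (normc_ge_Re _).
rewrite (le_trans (le_normcD _ _)) // normc1 normcM normc_real zr.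
apply: le_trans (expR_ge1Dx _); rewrite lerD2l normrM mulrAC.
rewrite normfV [`|M.+1%:R|]ger0_norm //.
apply: ler_wpM2r; first by rewrite invr_ge0 ltW.
by apply: ler_wpM2r => //; rewrite ltW.
Qed.

End GrowthNonpositive.

(** * The growth rate is at most [|w|]: positive parameters *)

Section GrowthPositive.
Variable R : realType.

(** Let [zeta = 1 / (1 + w)]. This is the angle under which the segment
    from 0 to 1 is seen from [zeta], which is the argument of
    [(1 - zeta) / (- zeta) = - w]. *)
Lemma atan_subtended (K h : R) : 0 < K -> 0 < h < pi -> h = K * sin h ->
  let q := 1 - K * cos h in
  atan ((q ^+ 2 + h ^+ 2 - q) / h) + atan (q / h) = h.
Proof.
move=> K0 /andP[h0 hpi] hK q; set B := atan (q / h).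
have s0 : 0 < sin h by rewrite sin_gt0_pi // h0.
have B1 : - (pi / 2) < B := atan_gtNpi2 _.
have B2 : B < pi / 2 := atan_ltpi2 _.
have cB : 0 < cos B by rewrite cos_gt0_pihalf // B1.
have sB : sin B = q / h * cos B.
  by have := atanK (q / h); rewrite -/B /tan => <-; rewrite divfK // gt_eqF.
have cE : cos (h - B) = cos B / K.
  have e : sin h * (q / h) = q / K.
    transitivity (K * sin h / h * (q / K)); first by field; rewrite !gt_eqF.
    by rewrite -hK divff ?gt_eqF // mul1r.
  rewrite cosB sB mulrA e /q; field.
  by rewrite gt_eqF.
have sE : sin (h - B) = cos B * (sin h - cos h * (q / h)).
  by rewrite sinB sB; ring.
have c0 : 0 < cos (h - B) by rewrite cE divr_gt0.
have hB : h - B < pi / 2.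
  rewrite ltNge; apply/negP => hB; have := @cos_ge0_pihalf R (h - B - pi).
  have -> : cos (h - B - pi) = - cos (h - B) by rewrite cosB cospi sinpi; ring.
  have -> : - (pi / 2) <= h - B - pi <= pi / 2 by apply/andP; split; lra.
  by move=> /(_ isT); lra.
suff -> : (q ^+ 2 + h ^+ 2 - q) / h = tan (h - B).
  by rewrite tanK ?subrK // in_itv /=; apply/andP; split; lra.
rewrite /tan cE sE.
have qE : K * cos h = 1 - q by rewrite /q; ring.
move: (cos h) (sin h) hK qE s0 => ch sh hK qE s0.
transitivity (K * sh - (K * ch) * (q / h)); last by field; rewrite !gt_eqF.
by rewrite qE -hK; field; rewrite gt_eqF.
Qed.

(** Put [zeta = 1 / (1 + w) = a + i c] and [r = |zeta|], so that
    [|1 - zeta| = K r]. For [|z| = n r] with [Re z = n X], the square of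
    [|j - z| / n] at [t = j / n] is [Q t - 2 t (X - a)], where
    [Q t = |t - zeta|^2]. As [1 + u <= e^u], this is at most
    [Q t exp (- 2 (X - a) m t)] with [m t = t / Q t]. The product over [j]
    brings in the Riemann sums of [l = ln |t - zeta|] and of [m], with
    antiderivatives [F] and [G]. The choice of [zeta] is such that the integral
    of [m] is [b], so that [X] disappears from the bound up to a constant
    factor, and that [a b] plus the integral of [l] is [ln K + ln r]. *)
Lemma lambert_growth_pos (b K h : R) : 0 < K -> 0 < h < pi -> h = K * sin h ->
  ln K - K * cos h = b - 1 ->
  exists C r : R, 0 <= r /\ forall b' n,
    `|(lambert_poly R n.+1).[b']| <= C * (K * expR (r * `|b' - b|)) ^+ n.+1.
Proof.
move=> K0 h0pi hK lnK_eq; have [h0 hpi] := andP h0pi.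
pose q := 1 - K * cos h; pose D := q ^+ 2 + h ^+ 2.
have D0 : 0 < D by rewrite ltr_wpDl ?sqr_ge0 // exprn_gt0.
have K2 : K ^+ 2 = D - 2 * q + 1.
  transitivity (K ^+ 2 * (cos h ^+ 2 + sin h ^+ 2)).
    by rewrite cos2Dsin2 mulr1.
  have h2 : h ^+ 2 = (K * sin h) ^+ 2 by rewrite -hK.
  by rewrite /D h2 /q; ring.
pose a := q / D; pose c := h / D; pose r := Num.sqrt D^-1.
have D0' : D != 0 by rewrite gt_eqF.
have c0 : 0 < c by rewrite divr_gt0.
have c0' : c != 0 by rewrite gt_eqF.
have r2 : r ^+ 2 = a ^+ 2 + c ^+ 2.
  rewrite sqr_sqrtr ?invr_ge0 ?(ltW D0) // /a /c !expr_div_n -mulrDl -/D.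
  by field.
have r0 : 0 < r by rewrite sqrtr_gt0 invr_gt0.
pose Q (x : R) := (x - a) ^+ 2 + c ^+ 2.
have Q0 x : 0 < Q x by rewrite ltr_wpDl ?sqr_ge0 // exprn_gt0.
have Q0' x : Q x != 0 by rewrite gt_eqF.
have Qc x : c ^+ 2 <= Q x by rewrite lerDr sqr_ge0.
have Qinv x : (Q x)^-1 <= (c ^+ 2)^-1 by rewrite lef_pV2 ?posrE ?exprn_gt0.
have Qd (x : R) : is_derive x (1 : R) Q (2 * (x - a)).
  by rewrite /Q; apply: is_derive_eq; rewrite /GRing.scale /=; ring.
pose l (x : R) := ln (Q x) / 2; pose dl (x : R) := (x - a) / Q x.
pose m (x : R) := x / Q x; pose dm (x : R) := (Q x)^-1 - 2 * x * dl x / Q x.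
pose T (x : R) := atan ((x - a) / c).
have ld (x : R) : is_derive x (1 : R) l (dl x).
  have lnd := @is_derive1_comp R (@ln R) Q x _ _ (is_derive1_ln (Q0 x)) (Qd x).
  have -> : l = (fun x => 2^-1 * (@ln R \o Q) x).
    by apply/funext => y; rewrite /l mulrC.
  apply: is_derive_eq; rewrite /GRing.scale /= /dl; field.
  exact: Q0'.
have md (x : R) : is_derive x (1 : R) m (dm x).
  have Vd := @is_deriveV R Q x _ 1 (Q0' x) (Qd x).
  rewrite /m; apply: is_derive_eq; rewrite /GRing.scale /= /dm /dl; field.
  exact: Q0'.
have Td (x : R) : is_derive x (1 : R) T (c / Q x).
  have ud : is_derive x (1 : R) (fun x : R => (x - a) / c) c^-1.
    have -> : (fun x : R => (x - a) / c) = (fun x => c^-1 * (x - a)).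
      by apply/funext => y; rewrite mulrC.
    by apply: is_derive_eq; rewrite /GRing.scale /=; ring.
  have H := @is_derive1_comp R (@atan R) _ x _ _ (is_derive1_atan _) ud.
  apply: (is_derive_eq H); rewrite /Q; field.
  by rewrite c0' (Q0' x).
pose F (x : R) := (x - a) * l x - x + c * T x.
have Fd (x : R) : is_derive x (1 : R) F (l x).
  rewrite /F; apply: is_derive_eq; rewrite /GRing.scale /= /dl /Q; field.
  exact: (Q0' x).
pose G (x : R) := l x + a / c * T x.
have Gd (x : R) : is_derive x (1 : R) G (m x).
  rewrite /G; apply: is_derive_eq; rewrite /GRing.scale /= /dl /m /Q; field.
  by rewrite c0' (Q0' x).
have dl_le (x : R) : `|dl x| <= c^-1.
  rewrite /dl normrM normfV (ger0_norm (ltW (Q0 x))) ler_pdivrMr // mulrC.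
  rewrite ler_pdivlMr // -(ger0_norm (ltW c0)) -normrM ler_norml /Q.
  have := sqr_ge0 (x - a - c); have := sqr_ge0 (x - a + c).
  by move=> *; apply/andP; split; nra.
pose Lm := (c ^+ 2)^-1 + 2 * c^-1 * (c ^+ 2)^-1.
have dm_le (x : R) : 0 <= x <= 1 -> `|dm x| <= Lm.
  move=> /andP[x0 x1]; rewrite /dm (le_trans (ler_normB _ _)) // lerD //.
    by rewrite ger0_norm ?Qinv // invr_ge0 ltW.
  rewrite 3!normrM normr_nat (ger0_norm x0) (@ger0_norm _ (Q x)^-1); last first.
    by rewrite invr_ge0 ltW.
  rewrite ler_pM ?mulr_ge0 ?invr_ge0 ?(ltW (Q0 x)) //.
  rewrite ler_pM ?mulr_ge0 // ?dl_le //; lra.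
have rD : r ^+ 2 = D^-1 by rewrite sqr_sqrtr // invr_ge0 ltW.
have bE : b = ln K + q by rewrite /q; lra.
have T01 : T 1 - T 0 = h.
  rewrite /T sub0r mulNr atanN opprK -[RHS](atan_subtended K0 h0pi hK).
  by congr (atan _ + atan _); rewrite /a /c -/q -/D; field; rewrite D0' gt_eqF.
have l0 : l 0 = ln r.
  rewrite /l /Q sub0r sqrrN -r2 lnXn // mulr2n; lra.
have l1 : l 1 = ln K + ln r.
  have QE : Q 1 = (K * r) ^+ 2.
    rewrite exprMn rD K2 (_ : Q 1 = 1 - 2 * a + r ^+ 2); last first.
      by rewrite /Q r2; ring.
    by rewrite rD /a; field.
  rewrite /l QE lnXn ?mulr_gt0 // lnM ?posrE // mulr2n; lra.
have ach : a * q + c * h = 1 by rewrite /a /c /D; field.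
have F1 : F 1 - F 0 + a * b = ln K + ln r.
  have cT : c * T 1 = c * T 0 + c * h by rewrite -T01; ring.
  rewrite /F l0 l1 cT bE; lra.
have G1 : G 1 - G 0 = b.
  have acT : a / c * T 1 = a / c * T 0 + q.
    have -> : q = a / c * h by rewrite /a /c; field; rewrite D0' gt_eqF.
    by rewrite -T01; ring.
  rewrite /G l0 l1 acT bE; lra.
pose E1 := c^-1 + `|l 1|; pose E2 := Lm + `|m 1|.
pose C0 := E1 + 2 * r * E2.
exists (expR C0), r; split=> [|b' n]; first exact: ltW.
have N0 : (0 : R) < n.+1%:R by rewrite ltr0n.
set N : R := n.+1%:R in N0 *.
have Nr0 : 0 < N * r by rewrite mulr_gt0.
pose S1 := \sum_(j < n) l (j.+1%:R / N).
pose S2 := \sum_(j < n) m (j.+1%:R / N).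
have S1_le : `|S1 - N * (F 1 - F 0)| <= E1.
  have := riemann_sum n (fun x _ => Fd x) (fun x _ => ld x)
    (fun x _ => dl_le x).
  rewrite -/N big_ord_recr /= -/S1 divff ?gt_eqF // /E1 => H.
  rewrite (_ : S1 - _ = S1 + l 1 - N * (F 1 - F 0) - l 1); last by ring.
  by rewrite (le_trans (ler_normB _ _)) // lerD.
have S2_le : `|S2 - N * b| <= E2.
  have := riemann_sum n (fun x _ => Gd x) (fun x _ => md x) dm_le.
  rewrite -/N big_ord_recr /= -/S2 divff ?gt_eqF // G1 /E2 => H.
  rewrite (_ : S2 - _ = S2 + m 1 - N * b - m 1); last by ring.
  by rewrite (le_trans (ler_normB _ _)) // lerD.
rewrite -(ler_pM2r (exprn_gt0 n.+1 Nr0)).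
apply: (@lambert_cauchy _ _ _ _ (b' ^+ 2 * (N * r) ^+ 2 / 2)); first exact: Nr0.
move=> M [x y] zr; rewrite horner_lambert_approx normcM normcX normc_prod.
have zr2 : x ^+ 2 + y ^+ 2 = (N * r) ^+ 2.
  by rewrite -zr /normc sqr_sqrtr // addr_ge0 ?sqr_ge0.
have M0 : (0 : R) < M.+1%:R by rewrite ltr0n.
pose X := x / N; have xE : x = N * X by rewrite /X mulrC divfK // gt_eqF.
have normc_le (w : R[i]) (u : R) :
    complex.Re w ^+ 2 + complex.Im w ^+ 2 <= expR (2 * u) -> normc w <= expR u.
  case: w => p s /= ps; rewrite -(ger0_norm (expR_ge0 u)) -sqrtr_sqr.
  by rewrite ler_wsqrtr // -expRM_natl.
have expM : normc (1 + (b' / M.+1%:R)%:C%C * Complex x y) ^+ M.+1 <=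
    expR (b' * x + b' ^+ 2 * (N * r) ^+ 2 / 2 / M.+1%:R).
  set u := b' * x / M.+1%:R + (b' / M.+1%:R) ^+ 2 * (N * r) ^+ 2 / 2.
  have -> : b' * x + b' ^+ 2 * (N * r) ^+ 2 / 2 / M.+1%:R = M.+1%:R * u.
    rewrite /u; move: (M.+1%:R : R) M0 => M' M0; field.
    by rewrite gt_eqF.
  rewrite expRM_natl lerXn2r ?nnegrE ?expR_ge0 //.
    exact: le_trans (normr_ge0 _) (normc_ge_Re _).
  apply: normc_le; apply: le_trans (expR_ge1Dx _).
  rewrite /u -zr2 /= le_eqVlt; apply/orP; left; apply/eqP; field.
  by rewrite gt_eqF.
have prodM : \prod_(j < n) normc (j.+1%:R%:C%C - Complex x y) <=
    N ^+ n * expR (S1 - (X - a) * S2).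
  have -> : N ^+ n * expR (S1 - (X - a) * S2) = \prod_(j < n)
      (N * expR (l (j.+1%:R / N) - (X - a) * m (j.+1%:R / N))).
    rewrite big_split /= prodr_const card_ord -expR_sum; congr (_ * expR _).
    by rewrite sumrB -mulr_sumr.
  apply: ler_prod => j _; rewrite (le_trans (normr_ge0 _) (normc_ge_Re _)) /=.
  set t := j.+1%:R / N.
  have jE : j.+1%:R = N * t by rewrite mulrC divfK // gt_eqF.
  rewrite -[X in X * expR _](lnK N0) -expRD.
  apply: (normc_le (j.+1%:R%:C%C - Complex x y)).
  have -> : 2 * (ln N + (l t - (X - a) * m t)) =
      2%:R * ln N + (ln (Q t) + - (2 * (X - a) * m t)).
    by rewrite /l; field.
  rewrite !expRD expRM_natl !lnK ?posrE //.
  have -> : complex.Re (j.+1%:R%:C%C - Complex x y) ^+ 2 +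
      complex.Im (j.+1%:R%:C%C - Complex x y) ^+ 2 =
      N ^+ 2 * (Q t * (1 + - (2 * (X - a) * m t))).
    transitivity (j.+1%:R ^+ 2 - 2 * j.+1%:R * x + (x ^+ 2 + y ^+ 2)).
      by rewrite /=; ring.
    have -> : Q t * (1 + - (2 * (X - a) * m t)) = Q t - 2 * (X - a) * t.
      by rewrite /m; field; exact: Q0'.
    by rewrite zr2 jE [(N * t) ^+ 2]exprMn [(N * r) ^+ 2]exprMn r2 xE /Q; ring.
  by rewrite ler_pM2l ?exprn_gt0 // ler_pM2l // expR_ge1Dx.
have abs_le (u : R) : u ^+ 2 <= r ^+ 2 -> `|u| <= r.
  by move=> ur; rewrite -(ger0_norm (ltW r0)) -!sqrtr_sqr ler_wsqrtr.
have Xr : `|X| <= r.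
  apply: abs_le; rewrite -(ler_pM2l (exprn_gt0 2 N0)) -!exprMn -xE -zr2.
  by rewrite lerDl sqr_ge0.
have ar : `|a| <= r by apply: abs_le; rewrite r2 lerDl sqr_ge0.
have XaE : `|X - a| <= 2 * r by rewrite (le_trans (ler_normB _ _)) //; lra.
apply: le_trans (ler_pM _ _ expM prodM) _.
- by rewrite exprn_ge0 // (le_trans (normr_ge0 _) (normc_ge_Re _)).
- by apply: prodr_ge0 => j _; exact: le_trans (normr_ge0 _) (normc_ge_Re _).
have KN : K ^+ n.+1 = expR (N * ln K) by rewrite /N expRM_natl lnK.
have rN : r ^+ n.+1 = expR (N * ln r) by rewrite /N expRM_natl lnK.
set E := b' ^+ 2 * (N * r) ^+ 2 / 2 / M.+1%:R.
have -> : expR C0 * (K * expR (r * `|b' - b|)) ^+ n.+1 *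
    (N * r) ^+ n.+1 * expR E =
    N ^+ n.+1 * expR (C0 + N * ln K + N * (r * `|b' - b|) + N * ln r + E).
  by rewrite !exprMn KN rN -[expR (r * _) ^+ _]expRM_natl !expRD; ring.
rewrite mulrCA -expRD ler_pM ?exprn_ge0 ?expR_ge0 ?(ltW N0) //.
  by apply: ler_weXn2l; rewrite ?ler1n.
rewrite ler_expR xE.
have b'b : b' * (N * X) <= b * (N * X) + N * (r * `|b' - b|).
  have : (b' - b) * X <= `|b' - b| * r.
    by apply: le_trans (ler_norm _) _; rewrite normrM ler_wpM2l.
  move=> /(ler_wpM2l (ltW N0)); lra.
have PS : - ((X - a) * (S2 - N * b)) <= 2 * r * E2.
  apply: le_trans (ler_norm _) _; rewrite normrN normrM ler_pM //.
move: S1_le => /ler_normlP[_ S1_le].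
have NF : N * (F 1 - F 0) = N * ln K + N * ln r - N * (a * b).
  by rewrite -mulrDr -F1; ring.
rewrite NF in S1_le; rewrite /C0; lra.
Qed.

End GrowthPositive.

(** * The domain of convergence *)

Section Domain.
Variable R : realType.

Lemma inner_sumE (s t : R) n : s != 0 ->
  inner_sum s t n = s ^+ n * (lambert_poly R n).[t / s].
Proof.
move=> s0; rewrite /inner_sum /lambert_poly horner_poly mulr_sumr.
rewrite big_ord_recl /=.
rewrite mul0r mulr0 add0r big_add1 /= big_mkord; apply: eq_bigr => m _.
rewrite /bump /= add1n expr_div_n.
have -> : s ^+ n = s ^+ (n - m.+1) * s ^+ m.+1 by rewrite -exprD subnK.
field; rewrite pnatr_eq0 -lt0n fact_gt0 expf_neq0 //.
Qed.

Lemma series_convergesE (s t : R) :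
  series_converges s t <-> cvgn (series (fun n => inner_sum s t n.+1)).
Proof.
rewrite /series_converges seriesEnat /=.
by under eq_fun do rewrite big_add1 /=.
Qed.

Lemma series_converges_geometric (s t C x : R) :
  0 < s -> 0 <= x -> s * x < 1 ->
  (forall n, `|(lambert_poly R n.+1).[t / s]| <= C * x ^+ n.+1) ->
  series_converges s t.
Proof.
move=> s0 x0 sx1 H; apply/series_convergesE.
have sx0 : 0 <= s * x by rewrite mulr_ge0 // ltW.
have le_geo n : `|inner_sum s t n.+1| <= geometric (C * (s * x)) (s * x) n.
  rewrite /= inner_sumE ?gt_eqF // normrM normrX (ger0_norm (ltW s0)).
  rewrite -mulrA -exprS exprMn mulrCA ler_wpM2l ?exprn_ge0 //.
  exact: ltW.
apply: normed_cvg; apply: (series_le_cvg _ _ le_geo) => [n|n|].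
- exact: normr_ge0.
- exact: le_trans (normr_ge0 _) (le_geo n).
by apply: is_cvg_geometric_series; rewrite ger0_norm.
Qed.

Lemma interior_ray (A : set (R * R)) (s t u v : R) :
  interior A (s, t) -> exists2 e : R, 0 < e & A (s + e * u, t + e * v).
Proof.
move=> As.
have path : (fun e : R => (s + e * u, t + e * v)) @ (0 : R) --> (s, t).
  have lin (c d : R) : (fun e : R => c + e * d) @ (0 : R) --> c.
    rewrite -[X in _ --> X]addr0 -[X in _ + X](mul0r d).
    apply: cvgD; first exact: cvg_cst.
    by apply: cvgM; [exact: cvg_id|exact: cvg_cst].
  exact: (cvg_pair (lin s u) (lin t v)).
have near0 : \forall e \near (0 : R)^'+, A (s + e * u, t + e * v).
  have near0 : \forall e \near (0 : R), A (s + e * u, t + e * v) := path A As.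
  by apply: cvg_within near0.
have [e [Ae e0]] := filter_ex (filterI near0 (nbhs_right_gt 0)).
by exists e.
Qed.

(** A convergent series has bounded terms, so that [p_n(t / s)] would be
    [O(s^(- n))]. *)
Lemma diverges_beyond (s t K h : R) : 0 < s -> t != 0 -> 0 < K -> 0 <= h < pi ->
  h = K * sin h -> ln K - K * cos h = t / s - 1 -> 1 < s * K ->
  ~ series_converges s t.
Proof.
move=> s0 t0 K0 h0pi hK lnKE sK /series_convergesE cv.
have [C ubC] := cvg_has_ub (cvgP _ (cvg_series_cvg_0 cv)).
have sK0 : 0 < s * K by rewrite mulr_gt0.
apply: (@lambert_growth_sharp R (t / s) K h C (s * K)^-1) => //.
- by rewrite mulf_neq0 // invr_eq0 gt_eqF.
- by rewrite invr_ge0 ltW //= invf_lt1.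
have C0 : 0 <= C.
  by apply: le_trans (normr_ge0 (inner_sum s t 1)) _; apply: ubC; exists 0%N.
case=> [|n]; first by rewrite lambert_poly0 horner0 normr0 expr0 mulr1.
have -> : (s * K)^-1 * K = s^-1 by field; rewrite !gt_eqF.
have /= : `|inner_sum s t n.+1| <= C by apply: ubC; exists n.
rewrite inner_sumE ?gt_eqF // normrM normrX (ger0_norm (ltW s0)).
by rewrite exprVn ler_pdivlMr ?exprn_gt0 // mulrC.
Qed.

Lemma cvg_quotient (s t : R) : s != 0 ->
  (fun p : R * R => p.2 / p.1) @ ((s, t) : R * R) --> t / s.
Proof.
by move=> s0; apply: cvgM; [exact: cvg_snd|apply: cvgV => //; exact: cvg_fst].
Qed.

End Domain.

Theorem theorem1 (R : realType) (sigma tau : R) (sigma_gt0 : 0 < sigma) :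
  convergence_domain (sigma, tau) <->
  ln sigma <
    1 - tau / sigma +
    complex.Re (lambertWm1 (- expR (tau / sigma - 1))).
Proof.
set b := tau / sigma; have s0 : sigma != 0 by rewrite gt_eqF.
have [K [h [[K0 h0pi hK lnKE ->] Kh]]] := lambertWm1_polar b.
have -> : (ln sigma < 1 - b + - (K * cos h)) = (sigma * K < 1).
  have -> : 1 - b + - (K * cos h) = - ln K by lra.
  rewrite -subr_lt0 opprK -lnM ?posrE // -ln1 ltr_ln ?posrE ?mulr_gt0 //.
have sK0 : 0 < sigma * K by rewrite mulr_gt0.
split=> [dom|sK].
  rewrite ltNge; apply/negP => sK.
  (* leave the point in a direction where the series diverges: radially, unless
     [tau = 0], where [tau] must become negative *)
  have [tau0|tau0] := eqVneq tau 0.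
    have [e e0 /= [s'0 cv]] := interior_ray sigma (- 1) dom.
    move: cv s'0; rewrite tau0 add0r mulrN1.
    set s' := sigma + _ => cv s'0.
    have b'0 : - e / s' < 0 by rewrite mulNr oppr_lt0 divr_gt0.
    have [K' [h' [[K'0 h'0pi hK' lnKE' _]]]] := lambertWm1_polar (- e / s').
    rewrite (ltW b'0) => -[h'0 K'1].
    have K'gt1 : 1 < K'.
      rewrite lt_def K'1 andbT; apply/eqP => K'E; move: lnKE'.
      rewrite K'E h'0 ln1 cos0; lra.
    have K1 : K = 1.
      move: Kh; rewrite /b tau0 mul0r lexx => -[hh _]; move: lnKE.
      rewrite /b tau0 mul0r hh cos0 => lnKE.
      by apply/eqP; apply: contraT => /(ln_lt_subr1 K0) ?; exfalso; lra.
    apply: (diverges_beyond s'0 _ K'0 h'0pi hK' lnKE' _ cv).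
      by rewrite oppr_eq0 gt_eqF.
    have es : 0 < e * sigma by rewrite mulr_gt0.
    have s'1 : 1 < s' by rewrite K1 mulr1 in sK; rewrite /s'; lra.
    by apply: (lt_trans s'1); rewrite ltr_pMr.
  have [e e0 /= [s'0 cv]] := interior_ray sigma tau dom.
  move: cv s'0; set s' := sigma + _; set t' := tau + _ => cv s'0.
  have bE : t' / s' = b.
    by rewrite /t' /s' /b; field; rewrite s0 /=; apply: lt0r_neq0.
  apply: (diverges_beyond s'0 _ K0 h0pi hK _ _ cv).
  - rewrite (_ : t' = (1 + e) * tau); last by rewrite /t'; ring.
    by rewrite mulf_neq0 // gt_eqF // addr_gt0.
  - by rewrite bE.
  - rewrite (_ : s' = (1 + e) * sigma); last by rewrite /s'; ring.
    by rewrite -mulrA; apply: (le_lt_trans sK); rewrite ltr_pMl // ltrDl.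
rewrite /convergence_domain /interior /=.
have fst_cvg : (fun p : R * R => p.1) @ ((sigma, tau) : R * R) --> sigma.
  exact: cvg_fst.
have quo_cvg := @cvg_quotient _ sigma tau s0.
have fst_pos := cvgr_gt _ fst_cvg _ sigma_gt0.
case: (leP b 0) Kh => b0 Kh.
  have [h0 K1] := Kh.
  have Ks : K < sigma^-1 by rewrite -(ltr_pM2l sigma_gt0) divff.
  (* [- y] plays the part of [w] for some [b'] with [|b| < |b'|], which leaves a
     neighbourhood of [b] *)
  have [] := midf_lt Ks; set y := (K + sigma^-1) / 2 => Ky ys.
  have y1 : 1 < y by apply: le_lt_trans Ky.
  have y0 : 0 < y by apply: lt_trans y1.
  have [C HC] := lambert_growth_nonpos y1.
  have bB : `|b| < y - 1 - ln y.
    have bE : `|b| = K - 1 - ln K.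
      by rewrite ler0_norm //; move: lnKE; rewrite h0 cos0; lra.
    have yK : y / K != 1.
      by rewrite -(inj_eq (mulIf (lt0r_neq0 K0))) divfK ?mul1r ?gt_eqF.
    have := ln_lt_subr1 (divr_gt0 y0 K0) yK.
    rewrite ln_div ?posrE //.
    have : y / K - 1 <= y - K.
      rewrite -[X in _ - X](divff (lt0r_neq0 K0)) -mulrBl ler_pdivrMr //.
      by rewrite ler_peMr // subr_ge0 ltW.
    rewrite bE; lra.
  have ys' : sigma < y^-1 by rewrite -[ltLHS]invrK ltf_pV2 ?posrE ?invr_gt0.
  have quo_lt := cvgr_lt _ (cvg_norm quo_cvg) _ bB.
  have fst_lt := cvgr_lt _ fst_cvg _ ys'.
  near=> p; have p0 : 0 < p.1 by near: p; exact: fst_pos.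
  split=> //; apply: (@series_converges_geometric _ _ _ C y) => //.
  - exact: ltW.
  - have : p.1 < y^-1 by near: p; exact: fst_lt.
    by rewrite -ltr_pdivlMr // mul1r.
  - move=> n; apply: HC; apply: ltW; near: p; exact: quo_lt.
have [C [r [r0 HC]]] : exists C r : R, 0 <= r /\ forall b' n,
    `|(lambert_poly R n.+1).[b']| <= C * (K * expR (r * `|b' - b|)) ^+ n.+1.
  have [_ hpi] := andP h0pi.
  by apply: (@lambert_growth_pos _ _ K h) => //; rewrite Kh.
have lt1 : (fun p : R * R => p.1 * (K * expR (r * `|p.2 / p.1 - b|)))
    @ ((sigma, tau) : R * R) --> sigma * (K * expR (r * `|b - b|)).
  apply: cvgM => //; apply: cvgM; first exact: cvg_cst.
  apply: continuous_cvg; first exact: continuous_expR.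
  apply: cvgM; first exact: cvg_cst.
  by apply: cvg_norm; apply: cvgB => //; exact: cvg_cst.
have lim_lt1 : sigma * (K * expR (r * `|b - b|)) < 1.
  by rewrite subrr normr0 mulr0 expR0 mulr1.
have near_lt1 := cvgr_lt _ lt1 _ lim_lt1.
near=> p; have p0 : 0 < p.1 by near: p; exact: fst_pos.
split=> //; apply: (series_converges_geometric p0 _ _ (HC (p.2 / p.1))).
- by rewrite mulr_ge0 ?expR_ge0 // ltW.
- by near: p; exact: near_lt1.
Unshelve. all: by end_near. Qed.
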